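(* Let $0<\alpha<\pi$ and $0<\gamma<2$. The discrete map $Z^{\gamma}$, i.e. the solution $f:\mathbf{Z}^2_+\to\mathbf{C}$ of $$\frac{(f_{n,m}-f_{n+1,m})(f_{n+1,m+1}-f_{n,m+1})}{(f_{n+1,m}-f_{n+1,m+1})(f_{n,m+1}-f_{n,m})}=e^{-2i\alpha},$$ $$\gamma f_{n,m}=2n\frac{(f_{n+1,m}-f_{n,m})(f_{n,m}-f_{n-1,m})}{f_{n+1,m}-f_{n-1,m}}+2m\frac{(f_{n,m+1}-f_{n,m})(f_{n,m}-f_{n,m-1})}{f_{n,m+1}-f_{n,m-1}}$$ with initial conditions $f_{1,0}=1$, $f_{0,1}=e^{i\gamma\alpha}$, is embedded.
   Context: $\mathbf{Z}^2_+=\{(n,m)\in\mathbf{Z}^2: n,m\ge 0\}$. Both equations are required for all $(n,m)\in\mathbf{Z}^2_+$; in the second equation (the constraint) a summand with coefficient $n=0$ or $m=0$ is taken to be $0$ (so $f_{0,0}=0$). The constraint determines $f$ along the axes $(n,0)$ and $(0,m)$ from $f_{1,0}$, $f_{0,1}$, and the first (cross-ratio) equation then determines all other values. The elementary quadrilaterals of $f$ are the quadrilaterals with consecutive vertices $(f_{n,m},f_{n+1,m},f_{n+1,m+1},f_{n,m+1})$, $(n,m)\in\mathbf{Z}^2_+$. A discrete map $f$ is called embedded if the inner parts (interiors) of different elementary quadrilaterals do not intersect. *)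

(* Defs.v *)
From mathcomp Require Export all_boot all_order all_algebra complex.
From mathcomp Require Export all_classical all_reals all_analysis.
Export Order.TTheory GRing.Theory Num.Theory numFieldNormedType.Exports.

Set Implicit Arguments.
Unset Strict Implicit.
Unset Printing Implicit Defensive.

Local Open Scope classical_set_scope.
Local Open Scope complex_scope.
Local Open Scope ring_scope.

Section DiscreteMaps.
Context {R : realType}.

(* e^{i t} *)
Definition expi (t : R) : R[i] := cos t +i* sin t.

(* Division is total with x / 0 = 0; in the equation [cross_ratio f n m = q]
   with q != 0 this already forces the denominator to be nonzero. *)
Definition cross_ratio (f : nat -> nat -> R[i]) (n m : nat) : R[i] :=
  ((f n m - f n.+1 m) * (f n.+1 m.+1 - f n m.+1)) /
  ((f n.+1 m - f n.+1 m.+1) * (f n m.+1 - f n m)).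

(* When n = 0 (resp. m = 0) the first (resp. second) summand vanishes because of
   its coefficient, so that the value of f at n.-1 = 0 plays no role there. *)
Definition constraint_rhs (f : nat -> nat -> R[i]) (n m : nat) : R[i] :=
  2%:R * n%:R * (((f n.+1 m - f n m) * (f n m - f n.-1 m)) /
                 (f n.+1 m - f n.-1 m)) +
  2%:R * m%:R * (((f n m.+1 - f n m) * (f n m - f n m.-1)) /
                 (f n m.+1 - f n m.-1)).

(* [dZ_defined_n] and [dZ_defined_m] say that the quotients which really occur
   in the constraint are defined, so that x / 0 = 0 is never used. *)
Record discrete_Zgamma (alpha gamma : R) (f : nat -> nat -> R[i]) : Prop := {
  dZ_cross_ratio : forall n m, cross_ratio f n m = expi (- (2%:R * alpha));
  dZ_defined_n : forall n m, (0 < n)%N -> f n.+1 m - f n.-1 m != 0;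
  dZ_defined_m : forall n m, (0 < m)%N -> f n m.+1 - f n m.-1 != 0;
  dZ_constraint : forall n m, gamma%:C * f n m = constraint_rhs f n m;
  dZ_init10 : f 1%N 0%N = 1;
  dZ_init01 : f 0%N 1%N = expi (gamma * alpha)
}.

(* R[i]^o carries the usual (normed) topology of the complex plane. *)
Definition segment (a b : R[i]) : set R[i]^o :=
  [set (1 - t)%:C * a + t%:C * b | t in `[0, 1]%classic].

Definition quad_boundary (a b c d : R[i]) : set R[i]^o :=
  segment a b `|` segment b c `|` segment c d `|` segment d a.

(* The points off the boundary polygon whose connected component in the
   complement of that polygon is bounded. For a simple quadrilateral, convex or
   not, this is its Jordan interior. (The quadrilaterals of Z^gamma need not be
   convex, so the convex hull of the vertices would not do.) *)
Definition inner_part (a b c d : R[i]) : set R[i]^o :=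
  [set z | (~` quad_boundary a b c d) z /\
           bounded_set (connected_component (~` quad_boundary a b c d) z)].

Definition elementary_quad_inner (f : nat -> nat -> R[i]) (n m : nat) :
    set R[i]^o :=
  inner_part (f n m) (f n.+1 m) (f n.+1 m.+1) (f n m.+1).

Definition embedded (f : nat -> nat -> R[i]) : Prop :=
  forall n m n' m' : nat, (n, m) <> (n', m') ->
    elementary_quad_inner f n m `&` elementary_quad_inner f n' m' = set0.

End DiscreteMaps.

(* Main.v *)
Require Import Defs.
From mathcomp Require Import ring lra zify.
Set Implicit Arguments.
Unset Strict Implicit.
Unset Printing Implicit Defensive.
Local Open Scope complex_scope.
Local Open Scope classical_set_scope.
Local Open Scope ring_scope.

(* The cross-ratio equation is equivalent to [f (n+1) m - f n m = w w'] and
   [f n (m+1) - f n m = e^(i alpha) w w'] for a function [w] on the vertices,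
   real (a signed radius) when [n + m] is even and of modulus 1 when [n + m] is
   odd. In terms of [w] the constraint becomes the discrete Euler equation
   [n (w_E - w_W) / (w_E + w_W) + m (w_N - w_S) / (w_N + w_S) = gamma - 1] when
   [n + m] is odd, and [= 0] when [n + m] is even.

   The radii are positive. If they are so on the diagonal [n = m], the Euler
   equation propagates positivity away from it. On the diagonal, the relative
   differences [P_n] of consecutive radii, as functions of [k = tan (alpha / 2)],
   satisfy an ordinary differential equation (the isomonodromic flow in [alpha])
   for which [|P_n| < 1] is an invariant region; they tend to
   [(gamma - 1) / (2 n + 1)] as [k] tends to [0], where they start inside it.

   Positive radii make every quadrilateral a union of two positively oriented
   triangles, and the constraint, which at odd vertices reads
   [gamma f = w (A + e^(i alpha) B)] with [A, B >= 0], makes the argument of [f]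
   increase in [m] and decrease in [n]. Count the signed crossings of
   quadrilaterals with a ray emanating from [z] and pointing away from the origin:
   each quadrilateral contributes a nonnegative number, at least 1 if [z] is
   inside, while the total over a square of the grid is a boundary term, which
   the monotonicity of the argument bounds by 1. *)

(** * Barriers and singular differential equations *)

Section Calc.
Context {R : realType}.
Implicit Types (f g F : R -> R) (x k d : R).

Lemma is_derive_add f g x df dg : is_derive x 1 f df -> is_derive x 1 g dg ->
  is_derive x 1 (fun y => f y + g y) (df + dg).
Proof. exact: is_deriveD. Qed.

Lemma is_derive_sub f g x df dg : is_derive x 1 f df -> is_derive x 1 g dg ->
  is_derive x 1 (fun y => f y - g y) (df - dg).
Proof. exact: is_deriveB. Qed.

Lemma is_derive_mul f g x df dg : is_derive x 1 f df -> is_derive x 1 g dg ->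
  is_derive x 1 (fun y => f y * g y) (df * g x + f x * dg).
Proof.
move=> Hf Hg; apply: (is_derive_eq (is_deriveM Hf Hg)).
by rewrite /GRing.scale /= addrC [g x * _]mulrC.
Qed.

Lemma is_derive_div f g x df dg : is_derive x 1 f df -> is_derive x 1 g dg ->
  g x != 0 ->
  is_derive x 1 (fun y => f y / g y) ((df * g x - f x * dg) / g x ^+ 2).
Proof.
move=> Hf Hg gx0; have Hv := is_deriveV gx0 Hg.
apply: (is_derive_eq (is_derive_mul Hf Hv)).
by rewrite /GRing.scale /=; field; rewrite gx0.
Qed.

Lemma is_derive_expr f n x df : is_derive x 1 f df ->
  is_derive x 1 (fun y => f y ^+ n) (n%:R * f x ^+ n.-1 * df).
Proof.
move=> Hf.
have -> : (fun y => f y ^+ n) = f ^+ n by apply/funext => y; rewrite exprfctE.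
exact: is_deriveX.
Qed.

Lemma is_derive_continuous f x d : is_derive x 1 f d -> {for x, continuous f}.
Proof.
by move=> Hf; apply/differentiable_continuous/derivable1_diffP; case: Hf.
Qed.

Lemma pos_derive_left f x d : is_derive x 1 f d -> 0 < d ->
  \forall y \near x^'-, f y < f x.
Proof.
move=> [Hd He] d0.
have /cvgrPdist_lt/(_ d d0) : h^-1 *: (f (h *: (1:R) + x) - f x) @[h --> 0^'] --> d.
  by rewrite -He; exact: Hd.
move=> /nbhs_ballP[e /= e0 He'].
exists e => //= y; rewrite /ball /= => yx ylt.
have yx0 : y - x != 0 by rewrite subr_eq0 lt_eqF.
have := He' (y - x).
rewrite /ball /= sub0r normrN distrC => /(_ yx yx0).
rewrite /GRing.scale /= mulr1 subrK.
have yxn : y - x < 0 by rewrite subr_lt0.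
move=> H; have : 0 < (y - x)^-1 * (f y - f x).
  by move: H; rewrite ltr_norml => /andP[_]; lra.
by rewrite nmulr_rgt0 ?invr_lt0 // subr_lt0.
Qed.

(** At the infimum [m] of the points where [F <= 0], continuity gives [F m = 0]; then [0 < dF m]
    makes [F] negative just to the left of [m], contrary to the choice of [m]. *)
Lemma barrier F (dF : R -> R) :
  (forall k, 0 < k -> is_derive k 1 F (dF k)) ->
  (forall k, 0 < k -> F k = 0 -> 0 < dF k) ->
  (\forall k \near 0^'+, 0 < F k) -> forall k, 0 < k -> 0 < F k.
Proof.
move=> HF Hb [e /= e0 He] k0 k00; rewrite ltNge; apply/negP => Fk0.
pose S := [set k | 0 < k /\ F k <= 0].
have Slb k : S k -> e <= k.
  move=> [kp Fk]; rewrite leNgt; apply/negP => ke.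
  by have := He k; rewrite /ball /= sub0r normrN gtr0_norm // => /(_ ke kp);
    rewrite ltNge Fk.
have S0 : S k0 by [].
have hinf : has_inf S by split; [exists k0|exists e => k /Slb].
set m := inf S.
have me : e <= m by apply: lb_le_inf; [exists k0|move=> k /Slb].
have m0 : 0 < m by exact: lt_le_trans me.
have below k : 0 < k -> k < m -> 0 < F k.
  move=> kp km; rewrite ltNge; apply/negP => Fk.
  by move: km; rewrite ltNge => /negP; apply; apply: ge_inf => //; case: hinf.
have cF := is_derive_continuous (HF m m0).
have Fm : F m <= 0.
  rewrite leNgt; apply/negP => Fmp.
  have /nbhs_ballP[r /= r0 Hr] : \forall k \near m, 0 < F k.
    exact: (@cvgr_gt R R (nbhs m) _ F (F m) cF 0 Fmp).
  have [k Sk km] := inf_adherent r0 hinf.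
  have mk : m <= k by apply: ge_inf => //; case: hinf.
  have : 0 < F k.
    apply: Hr; rewrite /ball /= distrC ger0_norm ?subr_ge0 //.
    by rewrite ltrBlDl.
  by case: Sk => _; rewrite leNgt => /negP.
have near_below : \forall k \near m^'-, 0 < F k.
  exists m => //= k; rewrite /ball /= => H km; apply: below => //.
  by move: H; rewrite gtr0_norm ?subr_gt0 //; lra.
have cFl : F k @[k --> m^'-] --> F m by apply: cvg_at_left_filter.
have Fm0 : F m = 0.
  apply/eqP; rewrite eq_le Fm /=.
  by apply: (cvgr_to_ge cFl); apply: filterS near_below => k /ltW.
have Hl := pos_derive_left (HF m m0) (Hb m m0 Fm0).
have [k [/= kp]] := @filter_ex _ _ (at_left_proper_filter m) _ (filterI near_below Hl).
by rewrite Fm0 ltNge (ltW kp).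
Qed.

(* With [V = (y - b / a) ^ 2] one gets [k V' <= - N V + 2 B' ^ 2] near [0], so
   that [k ^ N (V - c)] decreases for small [c], while [k ^ N V] tends to 0. *)
Lemma singular_ode_cvg (a b : R) (N : nat) (A B y : R -> R) :
  0 < a -> (0 < N)%N -> N%:R <= 2 * a - 1 ->
  (forall k, 0 < k -> is_derive k 1 y (((- a + A k) * y k + (b + B k)) / k)) ->
  A k @[k --> 0^'+] --> (0:R) -> B k @[k --> 0^'+] --> (0:R) ->
  k ^+ N * (y k - b / a) ^+ 2 @[k --> 0^'+] --> (0:R) ->
  y k @[k --> 0^'+] --> b / a.
Proof.
move=> a0 N0 Na Hy HA HB Hz.
pose z k := y k - b / a.
pose B' k := A k * (b / a) + B k.
have HB' : B' k @[k --> 0^'+] --> (0:R).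
  rewrite -[X in _ --> X]addr0; apply: cvgD => //.
  by rewrite -[X in _ --> X](mul0r (b / a)); apply: cvgM => //; exact: cvg_cst.
have dz k : 0 < k -> is_derive k 1 z (((- a + A k) * z k + B' k) / k).
  move=> k0; apply: (is_derive_eq (is_deriveB (Hy k k0) (is_derive_cst (b / a) k 1))).
  rewrite /z /B'; field; lra.
apply/cvgrPdist_le => e e0.
have e20 : 0 < e ^+ 2 / 2 by rewrite divr_gt0 // exprn_gt0.
have nearA : \forall k \near 0^'+, `|A k| <= 4^-1.
  by have /cvgrPdist_le/(_ 4^-1) := HA; rewrite invr_gt0 ltr0n => /(_ erefl);
    apply: filterS => k; rewrite sub0r normrN.
have nearB : \forall k \near 0^'+, 2 * (B' k) ^+ 2 <= e ^+ 2 / 2.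
  have e2 : 0 < e / 2 by lra.
  have /cvgrPdist_le/(_ _ e2) := HB'; apply: filterS => k; rewrite sub0r normrN => H.
  have : `|B' k| ^+ 2 <= (e / 2) ^+ 2 by rewrite lerXn2r // ?nnegrE // ltW.
  by rewrite real_normK ?num_real //; nra.
have [r /= r0 Hr] := filterI nearA nearB.
have {}Hr k : 0 < k -> k < r -> `|A k| <= 4^-1 /\ 2 * (B' k) ^+ 2 <= e ^+ 2 / 2.
  move=> k0 kr; apply: Hr => //.
  by rewrite /ball /= sub0r normrN gtr0_norm.
exists r => // k1; rewrite /ball /= sub0r normrN => + k10; rewrite gtr0_norm // => k1r.
suff : z k1 ^+ 2 <= e ^+ 2.
  move=> H; rewrite distrC -ler_sqr ?nnegrE ?(ltW e0) //.
  by rewrite real_normK ?num_real.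
pose W k := k ^+ N * (z k ^+ 2 - e ^+ 2).
suff W0 : W k1 <= 0.
  by move: W0; rewrite /W pmulr_rle0 ?exprn_gt0 // subr_le0.
pose dW k := k ^+ N * (N%:R * (z k ^+ 2 - e ^+ 2) + 2 * z k * ((- a + A k) * z k +
  B' k)) / k.
have HW k : 0 < k -> is_derive k 1 W (dW k).
  move=> k0.
  have HX : is_derive k 1 (fun x : R => x ^+ N) (N%:R * k ^+ N / k).
    apply: (is_derive_eq (is_derive_expr N (is_derive_id k 1))); rewrite /= mulr1.
    case: (N) => [|p]; first by rewrite !mul0r.
    by rewrite /= exprS; field; lra.
  have Hz2 := is_derive_sub (is_derive_expr 2 (dz k k0)) (is_derive_cst (e ^+ 2) k 1).
  apply: (is_derive_eq (is_derive_mul HX Hz2)).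
  by rewrite /dW /= expr1; field; lra.
have dW0 k : 0 < k -> k < r -> dW k <= 0.
  move=> k0 kr; rewrite /dW mulr_le0_ge0 ?invr_ge0 ?(ltW k0) //.
  rewrite pmulr_rle0 ?exprn_gt0 //.
  have [Ak Bk] := Hr k k0 kr.
  have [A1 A2] : - 4^-1 <= A k /\ A k <= 4^-1 by move: Ak; rewrite ler_norml => /andP.
  have z2 : 0 <= z k ^+ 2 by exact: sqr_ge0.
  have n0 : (1:R) <= N%:R by rewrite ler1n.
  have e2 : 0 <= (N%:R - 1) * e ^+ 2 by rewrite mulr_ge0 ?subr_ge0 ?sqr_ge0.
  have H1 : (N%:R - 2 * a + 2 * A k + 2^-1) * z k ^+ 2 <= 0.
    by rewrite mulr_le0_ge0 //; lra.
  have H2 : 0 <= (z k - 2 * B' k) ^+ 2 by exact: sqr_ge0.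
  nra.
have mono x y0 : 0 < x -> x <= y0 -> y0 < r -> W y0 <= W x.
  move=> x0 xy yr.
  apply: (@ler0_derive1_le_cc _ W x y0) => //; rewrite ?in_itv /= ?lexx ?xy //.
  - move=> t; rewrite in_itv /= => /andP[xt _].
    by have [] := HW t (lt_trans x0 xt).
  - move=> t; rewrite in_itv /= => /andP[xt ty].
    have [_ Ht] := HW t (lt_trans x0 xt).
    by rewrite derive1E Ht dW0 ?(lt_trans x0 xt) // (lt_trans ty yr).
  - apply: derivable_within_continuous => t; rewrite in_itv /= => /andP[xt _].
    by have [] := HW t (lt_le_trans x0 xt).
(* As [W] does not increase on []0, r[], one has [W k1 <= W k <= k ^+ N * z k ^+ 2] for [k < k1],
   and the right side tends to 0. *)
apply: (cvgr_to_ge Hz).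
exists k1 => //= k; rewrite /ball /= sub0r normrN => + k0; rewrite gtr0_norm // => kk1.
apply: (le_trans (mono k k1 k0 (ltW kk1) k1r)).
rewrite /W; apply: ler_wpM2l; first by rewrite exprn_ge0 // ltW.
by rewrite gerBl sqr_ge0.
Qed.

End Calc.

(** * Relative differences of the radii along the diagonal and their flow in [k] *)

Section Diag.
Context {R : realType}.
Implicit Types (k P G c n Q : R).

Lemma norm_lt1_mul_lt1 P Q : `|P| < 1 -> `|Q| < 1 -> 0 < 1 - P * Q.
Proof.
rewrite !ltr_norml => /andP[? ?] /andP[? ?].
have ? : 0 < (1 - P) * (1 + Q) by rewrite mulr_gt0; lra.
have ? : 0 < (1 + P) * (1 - Q) by rewrite mulr_gt0; lra.
lra.
Qed.

(* With [k = tan (alpha / 2)] and [r] the radii of the pattern, [P] and [G] stand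
   for [(r_{n+1,n+1} - r_{n,n}) / (r_{n+1,n+1} + r_{n,n})] and
   [(r_{n,n} - r_{n+1,n-1}) / (r_{n,n} + r_{n+1,n-1})]. Then [diag_s] and [diag_t]
   are the vertical and the horizontal relative differences of the radii around
   the vertex [(n+1, n)], tied by [(n + 1) t + n s = c = gamma - 1]. *)
Definition diag_s P G : R := (P + G) / (1 + P * G).
Definition diag_t c n P G : R := (c - n * diag_s P G) / (n + 1).
(** Relative differences add by the law of hyperbolic tangents; this one compares [r_{n+1,n+1}] with
    [r_{n+2,n}], so it is [G_(n+1)]. *)
Definition diag_G c n P G : R :=
  (P - diag_t c n P G) / (1 - P * diag_t c n P G).
(** With [P = P_n] and [G = G_(n+1)], the quotient [num / den] is [P_(n+1)]: [k * num / den] is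
    [tan (arctan (k P) + 2 arctan (G / k))]. The two are kept apart because [den] has first to be
    shown nonzero. *)
Definition diag_num k P G : R := P * (k ^+ 2 - G ^+ 2) + 2 * G.
Definition diag_den k P G : R := k ^+ 2 - G ^+ 2 - 2 * k ^+ 2 * P * G.
Definition diag_P k P G : R := diag_num k P G / diag_den k P G.

(* Right-hand sides of the equations [k dP_n/dk = odeP] and
   [k dG_n/dk = odeG]; [odeG'] and [odeP'] are the same quantities expressed by
   [P_(n-1), G_n] instead of [P_n, G_n], respectively by [P_n, G_(n+1)]. *)
Definition odeP c n k P G : R :=
  - P + (1 + k ^+ 2 * P ^+ 2) / (1 + k ^+ 2) * (c - 2 * n * diag_s P G).
Definition odeG c n k P G : R :=
  G + (c * (k ^+ 2 + G ^+ 2) -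
       2 * n * (1 - G ^+ 2) * (k ^+ 2 * P - G) / (1 + P * G)) / (1 + k ^+ 2).
Definition odeG' c n k P G : R :=
  G + (c * (k ^+ 2 + G ^+ 2) -
       2 * n * (1 - G ^+ 2) * (k ^+ 2 * P + G) / (1 - P * G)) / (1 + k ^+ 2).

(** After the substitution of [diag_P], both [1 + P_n G] and [k ^ 2 P_n - G] contain the factor
    [(k ^ 2 + G ^ 2) / diag_den], which cancels in [odeG]. *)
Lemma odeG'_eq c n k P G : 1 - P * G != 0 -> diag_den k P G != 0 ->
   k ^+ 2 + G ^+ 2 != 0 -> 1 + k ^+ 2 != 0 ->
  odeG' c n k P G = odeG c n k (diag_P k P G) G.
Proof.
move=> H1 H2 H3 H4; rewrite /odeG' /odeG.
have H5 : 1 + diag_P k P G * G = (k ^+ 2 + G ^+ 2) * (1 - P * G) / diag_den k P G.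
  by rewrite /diag_P /diag_num /diag_den; field.
have H6 : k ^+ 2 * diag_P k P G - G =
   (k ^+ 2 + G ^+ 2) * (k ^+ 2 * P + G) / diag_den k P G.
  by rewrite /diag_P /diag_num /diag_den; field.
rewrite H5 H6; field.
by rewrite H1 H2 H3 H4.
Qed.

(** First half of the compatibility of the flow with the recursion: the equations of index [n] yield
    the equation of [G_(n+1)], in the form that involves [P_n] but not yet [P_(n+1)]. *)
Lemma is_derive_diag_G c n (P G : R -> R) k : 0 < k -> 0 <= n ->
  is_derive k 1 P (odeP c n k (P k) (G k) / k) ->
  is_derive k 1 G (odeG c n k (P k) (G k) / k) ->
  `|P k| < 1 -> 1 + P k * G k != 0 -> `|diag_t c n (P k) (G k)| < 1 ->
  is_derive k 1 (fun x => diag_G c n (P x) (G x))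
    (odeG' c (n + 1) k (P k) (diag_G c n (P k) (G k)) / k).
Proof.
move=> k0 n0 dP dG P1 PG t1.
have D1 := norm_lt1_mul_lt1 P1 t1.
have k2 : 0 < k ^+ 2 by rewrite exprn_gt0.
have k1 : 1 + k ^+ 2 != 0 by rewrite gt_eqF //; lra.
have n1 : n + 1 != 0 by rewrite gt_eqF //; lra.
have k_n0 : k != 0 by rewrite gt_eqF.
have P2 : 1 - P k ^+ 2 != 0 by rewrite gt_eqF // expr2 norm_lt1_mul_lt1.
have ds := is_derive_div (is_derive_add dP dG)
   (is_derive_add (is_derive_cst (1:R) k 1) (is_derive_mul dP dG)) PG.
have dt := is_derive_div (is_derive_sub (is_derive_cst c k 1)
   (is_derive_mul (is_derive_cst n k 1) ds)) (is_derive_cst (n + 1) k 1) n1.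
have dd := is_derive_div (is_derive_sub dP dt) (is_derive_sub (is_derive_cst (1:R) k
  1) (is_derive_mul dP dt)) (lt0r_neq0 D1).
apply: (is_derive_eq dd).
rewrite /diag_G.
move: D1 P2 PG; rewrite /odeP /odeG /odeG' /cst /diag_t /diag_s.
move: (P k) (G k) => p g D1 P2 pg.
(* The factorizations [E5] and [E6] show that the denominators met by [field] are nonzero. *)
have E5 : (1 + p * g) * (n + 1) - p * (c * (1 + p * g) - n * (p + g)) =
    (1 + p * g) * (n + 1) * (1 - p * ((c - n * ((p + g) / (1 + p * g))) / (n + 1))).
  by field; rewrite pg n1.
field; rewrite k_n0 k1 n1 pg /= E5; apply/andP; split.
  by rewrite !mulf_neq0 // lt0r_neq0.
have E6 : (1 + p * g) * (n + 1) * (1 - p * ((c - n * ((p + g) / (1 + p * g))) / (n +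
  1))) -
    p * (p * ((1 + p * g) * (n + 1)) - (c * (1 + p * g) - n * (p + g))) =
    (1 + p * g) * (n + 1) * (1 - p ^+ 2) by field; rewrite pg n1.
by rewrite E6 !mulf_neq0.
Qed.

Definition odeP' c m k P G : R :=
  - P + (1 + k ^+ 2 * P ^+ 2) / (1 + k ^+ 2) *
    (2 * m * ((P - G) / (1 - P * G)) - c).

(** For fixed [P] the Möbius map [t -> (P - t) / (1 - P t)] is an involution. *)
Lemma diag_GK c n P G : 1 - P ^+ 2 != 0 -> 1 - P * diag_t c n P G != 0 ->
  (P - diag_G c n P G) / (1 - P * diag_G c n P G) = diag_t c n P G.
Proof.
move=> P2 H; rewrite /diag_G; move: H; move: (diag_t _ _ _ _) => t H.
field; rewrite H /=.
by rewrite (_ : 1 - P * t - P * (P - t) = 1 - P ^+ 2) //; ring.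
Qed.

(** By [diag_GK] the quotient in [odeP'] is [t], and [(n + 1) t + n s = c] turns [2 (n + 1) t - c]
    into [c - 2 n s]. *)
Lemma odeP'_eq c n k P G : n + 1 != 0 -> 1 - P ^+ 2 != 0 ->
  1 - P * diag_t c n P G != 0 ->
  odeP' c (n + 1) k P (diag_G c n P G) = odeP c n k P G.
Proof.
move=> n1 P2 H; rewrite /odeP' diag_GK // /odeP; congr (_ + _ * _).
rewrite /diag_t; move: (diag_s _ _) => s; field; exact: n1.
Qed.

Lemma is_derive_diag_num c m (P G : R -> R) k : 0 < k ->
  is_derive k 1 P (odeP' c m k (P k) (G k) / k) ->
  is_derive k 1 G (odeG' c m k (P k) (G k) / k) ->
  is_derive k 1 (fun x => diag_num x (P x) (G x))
   (odeP' c m k (P k) (G k) / k * (k ^+ 2 - G k ^+ 2) +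
    P k * (2 * k - 2 * G k * (odeG' c m k (P k) (G k) / k)) +
    2 * (odeG' c m k (P k) (G k) / k)).
Proof.
move=> k0 dP dG.
have dk2 := is_derive_expr 2 (is_derive_id k (1:R)).
have dG2 := is_derive_expr 2 dG.
apply: (is_derive_eq (is_derive_add (is_derive_mul dP (is_derive_sub dk2 dG2))
  (is_derive_mul (is_derive_cst (2:R) k 1) dG))).
by rewrite /cst /=; ring.
Qed.

Lemma is_derive_diag_den c m (P G : R -> R) k : 0 < k ->
  is_derive k 1 P (odeP' c m k (P k) (G k) / k) ->
  is_derive k 1 G (odeG' c m k (P k) (G k) / k) ->
  is_derive k 1 (fun x => diag_den x (P x) (G x))
   (2 * k - 2 * G k * (odeG' c m k (P k) (G k) / k) -
    (4 * k * P k * G k + 2 * k ^+ 2 * (odeP' c m k (P k) (G k) / k * G k +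
       P k * (odeG' c m k (P k) (G k) / k)))).
Proof.
move=> k0 dP dG.
have dk2 := is_derive_expr 2 (is_derive_id k (1:R)).
have dG2 := is_derive_expr 2 dG.
apply: (is_derive_eq (is_derive_sub (is_derive_sub dk2 dG2)
  (is_derive_mul (is_derive_mul (is_derive_mul (is_derive_cst (2:R) k 1) dk2) dP) dG))).
by rewrite /cst /=; ring.
Qed.

(** Second half of the compatibility: the equations of [P_(m-1)] and [G_m] yield that of [P_m]. *)
Lemma is_derive_diag_P c m (P G : R -> R) k : 0 < k ->
  is_derive k 1 P (odeP' c m k (P k) (G k) / k) ->
  is_derive k 1 G (odeG' c m k (P k) (G k) / k) ->
  1 - P k * G k != 0 -> diag_den k (P k) (G k) != 0 ->
  is_derive k 1 (fun x => diag_P x (P x) (G x))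
    (odeP c m k (diag_P k (P k) (G k)) (G k) / k).
Proof.
move=> k0 dP dG PG H.
have k2 : 0 < k ^+ 2 by rewrite exprn_gt0.
have k1 : 1 + k ^+ 2 != 0 by rewrite gt_eqF //; lra.
have k_n0 : k != 0 by rewrite gt_eqF.
apply: (is_derive_eq (is_derive_div (is_derive_diag_num k0 dP dG)
  (is_derive_diag_den k0 dP dG) H)).
have kG : k ^+ 2 + G k ^+ 2 != 0.
  by rewrite gt_eqF //; have := sqr_ge0 (G k); lra.
move: PG H kG; rewrite /diag_P /diag_num /diag_den /odeP /odeP' /odeG' /diag_s.
move: (P k) (G k) => p g PG H kG.
have E : k ^+ 2 - g ^+ 2 - 2 * k ^+ 2 * p * g + (p * (k ^+ 2 - g ^+ 2) + 2 * g) * g =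
  (k ^+ 2 + g ^+ 2) * (1 - p * g) by ring.
by field; rewrite k_n0 k1 PG H E /= mulf_neq0.
Qed.

(** Squared moduli in [den + i k num = (1 + i k P) (k + i G) ^ 2]. *)
Lemma diag_num_den k P G :
  diag_num k P G ^+ 2 * k ^+ 2 + diag_den k P G ^+ 2 =
  (k ^+ 2 + G ^+ 2) ^+ 2 * (1 + k ^+ 2 * P ^+ 2).
Proof. by rewrite /diag_num /diag_den; ring. Qed.

(* Where [P_(n+1)] reaches [1] or [-1] its derivative points inward, whatever
   the value of [G]. *)
Lemma diag_num_lt_den c m (P G : R -> R) : `|c| < 1 -> 0 <= m ->
  (forall k, 0 < k -> is_derive k 1 P (odeP' c m k (P k) (G k) / k)) ->
  (forall k, 0 < k -> is_derive k 1 G (odeG' c m k (P k) (G k) / k)) ->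
  (forall k, 0 < k -> `|P k| < 1) -> (forall k, 0 < k -> `|G k| < 1) ->
  (\forall k \near 0^'+,
     diag_num k (P k) (G k) ^+ 2 < diag_den k (P k) (G k) ^+ 2) ->
  forall k, 0 < k -> diag_num k (P k) (G k) ^+ 2 < diag_den k (P k) (G k) ^+ 2.
Proof.
move=> c1 m0 dP dG P1 G1 near0 k kp; rewrite -subr_gt0.
have dnum x (x0 : 0 < x) := is_derive_diag_num x0 (dP x x0) (dG x x0).
have dden x (x0 : 0 < x) := is_derive_diag_den x0 (dP x x0) (dG x x0).
(* The barrier is applied to [den ^ 2 - num ^ 2] instead of [1 - (num / den) ^ 2], since [den] might
   still vanish somewhere. *)
have dF x (x0 : 0 < x) := is_derive_sub (is_derive_expr 2 (dden x x0))
  (is_derive_expr 2 (dnum x x0)).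
apply: (barrier dF) kp; last by apply: filterS near0 => x; rewrite subr_gt0.
move=> {}k k0 /eqP; rewrite subr_eq0 => /eqP Heq.
set num := diag_num k (P k) (G k) in Heq *; set den := diag_den k (P k) (G k) in Heq *.
have k2 : 0 < k ^+ 2 by rewrite exprn_gt0.
have G2 := sqr_ge0 (G k).
have den0 : den != 0.
  apply/eqP => H; have := diag_num_den k (P k) (G k).
  rewrite -/num -/den -Heq H expr0n /= mul0r addr0 => /esym/eqP.
  have P2 := sqr_ge0 (P k).
  rewrite mulf_eq0 !gt_eqF //.
    by rewrite ltr_pwDl // mulr_ge0 // ltW.
  by rewrite exprn_gt0 //; lra.
have PG1 := norm_lt1_mul_lt1 (P1 k k0) (G1 k k0).
have PGn : 1 - P k * G k != 0 by rewrite lt0r_neq0.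
(* The derivative of [num / den] at [k] is known both from the flow and from the quotient rule;
   comparison gives [num' * den - num * den']. *)
have [_ e1] := is_derive_diag_P k0 (dP k k0) (dG k k0) PGn den0.
have [_ e2] := is_derive_div (dnum k k0) (dden k k0) den0.
have := etrans (esym e2) e1; rewrite -/num -/den.
set num' := (X in X * den - _); set den' := (X in _ - num * X).
rewrite {1}/diag_P -/num -/den.
set q := num / den => E.
have qden : num = q * den by rewrite /q divfK.
have q2 : q ^+ 2 = 1.
  by rewrite /q expr_div_n -Heq divff // sqrf_eq0.
have G1k := G1 k k0; move: G1k; rewrite ltr_norml => /andP[Ga Gb].
(* Composition with [G] fixes [1] and [-1], which removes [G] from the flow on the boundary of the
   region. *)
have s_eq : diag_s q (G k) = q.
  rewrite /diag_s; have : (q - 1) * (q + 1) = 0 by rewrite -subr_sqr expr1n q2 subrr.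
  move/eqP; rewrite mulf_eq0 => /orP[]; rewrite ?subr_eq0 ?addr_eq0 => /eqP ->.
    by rewrite mul1r divff // gt_eqF //; lra.
  by field; rewrite gt_eqF //; lra.
have {}E : num' * den - num * den' = den ^+ 2 * ((- q + (c - 2 * m * q)) / k).
  have -> : - q + (c - 2 * m * q) = odeP c m k q (G k).
    by rewrite /odeP s_eq q2 mulr1 divff ?mul1r // gt_eqF //; lra.
  by rewrite -E; field.
have -> : 2%:R * den ^+ 2.-1 * den' - 2%:R * num ^+ 2.-1 * num' =
   - 2 * q * (num' * den - num * den') + 2 * num' * (q * den - num) +
     2 * den * den' * (1 - q ^+ 2) + 2 * q * den' * (q * den - num).
  by rewrite /= !expr1; ring.
rewrite -qden subrr q2 subrr !mulr0 !addr0 E.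
have -> : - 2 * q * (den ^+ 2 * ((- q + (c - 2 * m * q)) / k)) =
   2 * den ^+ 2 / k * (q ^+ 2 * (1 + 2 * m) - c * q) by field; rewrite gt_eqF.
rewrite mulr_gt0 //.
  by rewrite divr_gt0 // mulr_gt0 // exprn_even_gt0.
rewrite q2 mul1r.
have cq : c * q < 1.
  rewrite -subr_gt0.
  have : (q - 1) * (q + 1) = 0 by rewrite -subr_sqr expr1n q2 subrr.
  move: c1; rewrite ltr_norml => /andP[c1 c2].
  by move/eqP; rewrite mulf_eq0 => /orP[]; rewrite ?subr_eq0 ?addr_eq0 => /eqP ->; lra.
lra.
Qed.

End Diag.

(** * Limits as [k] tends to 0 *)

Section Diag.
Context {R : realType}.
Implicit Types (k c n m : R) (P G f g : R -> R).

Lemma cvg_id0 : (fun k : R => k) @ 0^'+ --> (0 : R).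
Proof. by apply: cvg_at_right_filter; exact: cvg_id. Qed.

Lemma near0_gt0 : \forall k \near (0:R)^'+, 0 < k.
Proof. by exists 1 => //= k _. Qed.

Lemma near_eq_cvg_to f g (l : R) : (\forall k \near 0^'+, f k = g k) ->
  f @ 0^'+ --> l -> g @ 0^'+ --> l.
Proof. by move=> E; apply: cvg_trans; exact: near_eq_cvg. Qed.

Lemma cvg_sqr f (l : R) : f @ 0^'+ --> l -> (fun k => f k ^+ 2) @ 0^'+ --> l ^+ 2.
Proof. by move=> H; under eq_fun do rewrite expr2; rewrite expr2; apply: cvgM. Qed.

(** For [y = G / k ^ 2] the equation reads [k y' = - (2 m + 1) y + c - 2 m p] up to terms that
    vanish with [k], where [p] is the limit of [P]; [singular_ode_cvg] applies. *)
Lemma cvg_G_div_sqr c m P G : 1 <= m ->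
  (forall k, 0 < k -> is_derive k 1 G (odeG' c m k (P k) (G k) / k)) ->
  (forall k, 0 < k -> `|P k| < 1) -> (forall k, 0 < k -> `|G k| < 1) ->
  P @ 0^'+ --> c / (2 * m - 1) -> G @ 0^'+ --> (0:R) ->
  (fun k => G k / k ^+ 2) @ 0^'+ -->
    (c - 2 * m * (c / (2 * m - 1))) / (2 * m + 1).
Proof.
move=> m1 dG P1 G1 Pl Gl; set p := c / (2 * m - 1) in Pl *.
pose mu k := (1 - G k ^+ 2) / ((1 - P k * G k) * (1 + k ^+ 2)).
pose A k := c * G k / (1 + k ^+ 2) - 2 * m * (mu k - 1).
pose B k := c * (1 / (1 + k ^+ 2) - 1) - 2 * m * (mu k * P k - p).
have cst (l : R) : (fun=> l) @ (0:R)^'+ --> l by exact: cvg_cst.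
have k2l : (fun k : R => k ^+ 2) @ 0^'+ --> (0:R).
  by have := cvg_sqr cvg_id0; rewrite expr0n.
have d1 : (fun k : R => 1 + k ^+ 2) @ 0^'+ --> (1:R).
  by rewrite -[X in _ --> X]addr0; apply: cvgD.
have i1 : (fun k : R => (1 + k ^+ 2)^-1) @ 0^'+ --> (1:R).
  by rewrite -[X in _ --> X]invr1; apply: cvgV => //; exact: oner_neq0.
have mul : mu @ 0^'+ --> (1:R).
  have H1 : (fun k => 1 - G k ^+ 2) @ 0^'+ --> (1:R).
    rewrite -[X in _ --> X]subr0; apply: cvgB => //.
    by have := cvg_sqr Gl; rewrite expr0n.
  have H2 : (fun k => (1 - P k * G k) * (1 + k ^+ 2)) @ 0^'+ --> (1:R).
    rewrite -[X in _ --> X]mulr1; apply: cvgM => //.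
    rewrite -[X in _ --> X]subr0; apply: cvgB => //.
    by rewrite -[X in _ --> X](mulr0 p); apply: cvgM.
  rewrite -[X in _ --> X](divr1 1); apply: cvgM => //.
  by apply: cvgV => //; exact: oner_neq0.
(* The exponent 5 is at most [2 (2 m + 1) - 1] because [1 <= m], and it cancels the [k ^ 4] under
   [G ^ 2] with one factor [k] to spare. *)
apply: (@singular_ode_cvg _ (2 * m + 1) _ 5 A B); rewrite //; try lra.
- move=> k k0.
  have k20 : k ^+ 2 != 0 by rewrite expf_neq0 // gt_eqF.
  have k2 : 0 < k ^+ 2 by rewrite exprn_gt0.
  have k1 : 1 + k ^+ 2 != 0 by rewrite gt_eqF //; lra.
  have PG : 1 - P k * G k != 0 by rewrite lt0r_neq0 // norm_lt1_mul_lt1 ?P1 ?G1.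
  apply: (is_derive_eq (is_derive_div (dG k k0) (is_derive_expr 2 (is_derive_id k 1))
    k20)).
  rewrite /A /B /mu /odeG' /p; field.
  by rewrite k1 PG (gt_eqF k0) /= gt_eqF //; lra.
- rewrite -[X in _ --> X](subrr (0:R)); apply: cvgB.
    rewrite -[X in _ --> X](mul0r (1:R)); apply: cvgM => //.
    by rewrite -[X in _ --> X](mulr0 c); apply: cvgM.
  rewrite -[X in _ --> X](mulr0 (2 * m)); apply: cvgM => //.
  by rewrite -[X in _ --> X](subrr (1:R)); apply: cvgB.
- rewrite -[X in _ --> X](subrr (0:R)); apply: cvgB.
    rewrite -[X in _ --> X](mulr0 c); apply: cvgM => //.
    rewrite -[X in _ --> X](subrr (1:R)); apply: cvgB => //.
    by under eq_fun do rewrite mul1r.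
  rewrite -[X in _ --> X](mulr0 (2 * m)); apply: cvgM => //.
  rewrite -[X in _ --> X](subrr p); apply: cvgB => //.
  by rewrite -[X in _ --> X]mul1r; apply: cvgM.
- set b := (X in X / _).
  have E : \forall k \near (0:R)^'+, k * (G k - k ^+ 2 * (b / (2 * m + 1))) ^+ 2 =
     k ^+ 5 * (G k / k ^+ 2 - b / (2 * m + 1)) ^+ 2.
    apply: filterS near0_gt0 => k k0; field.
    have a1 : 2 * m + 1 != 0 by rewrite gt_eqF //; lra.
    by rewrite a1 gt_eqF.
  apply: (near_eq_cvg_to E).
  rewrite -[X in _ --> X](mul0r ((0 - 0 * (b / (2 * m + 1))) ^+ 2)).
  apply: cvgM; first exact: cvg_id0.
  apply: cvg_sqr; apply: cvgB => //; apply: cvgM => //.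
Qed.

(** Since [G] is of order [k ^ 2], division by [k ^ 2] leaves finite limits, whose quotient
    [c / (2 m + 1)] is the limit of the next [P]. *)
Lemma cvg_diag_num_den m c P G : 1 <= m ->
  (forall k, 0 < k -> is_derive k 1 G (odeG' c m k (P k) (G k) / k)) ->
  (forall k, 0 < k -> `|P k| < 1) -> (forall k, 0 < k -> `|G k| < 1) ->
  P @ 0^'+ --> c / (2 * m - 1) -> G @ 0^'+ --> (0:R) ->
  (fun k => diag_num k (P k) (G k) / k ^+ 2) @ 0^'+ --> c / (2 * m + 1) /\
  (fun k => diag_den k (P k) (G k) / k ^+ 2) @ 0^'+ --> (1:R).
Proof.
move=> m1 dG P1 G1 Pl Gl.
have yl := cvg_G_div_sqr m1 dG P1 G1 Pl Gl.
set y := (X in _ --> X) in yl.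
have cst (l : R) : (fun=> l) @ (0:R)^'+ --> l by exact: cvg_cst.
have Gy : (fun k => G k * (G k / k ^+ 2)) @ 0^'+ --> (0:R).
  by rewrite -[X in _ --> X](mul0r y); apply: cvgM.
split.
  have E : \forall k \near (0:R)^'+, P k * (1 - G k * (G k / k ^+ 2)) +
    2 * (G k / k ^+ 2) =
     diag_num k (P k) (G k) / k ^+ 2.
    apply: filterS near0_gt0 => k k0; rewrite /diag_num; field.
    by rewrite gt_eqF.
  apply: (near_eq_cvg_to E).
  have -> : c / (2 * m + 1) = c / (2 * m - 1) * (1 - 0) + 2 * y.
    by rewrite /y; field; rewrite !gt_eqF //; lra.
  apply: cvgD; last by apply: cvgM.
  by apply: cvgM => //; apply: cvgB.
have E : \forall k \near (0:R)^'+, (1 - G k * (G k / k ^+ 2)) - 2 * (P k * G k) =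
   diag_den k (P k) (G k) / k ^+ 2.
  apply: filterS near0_gt0 => k k0; rewrite /diag_den; field.
  by rewrite gt_eqF.
apply: (near_eq_cvg_to E).
rewrite -[X in _ --> X](_ : (1 - 0) - 2 * (c / (2 * m - 1) * 0) = 1);
  last by rewrite !mulr0 !subr0.
by apply: cvgB; [apply: cvgB|apply: cvgM => //; apply: cvgM].
Qed.

End Diag.

(** * Induction along the diagonal *)

Section Diag.
Context {R : realType}.
Implicit Types (k c : R) (n : nat) (P G f g : R -> R).

Fixpoint diagPG c k n : R * R :=
  match n with
  (* [r_{1,-1}] does not exist: this second component makes [odeG] hold for
     [n = 0] too. *)
  | 0%N => let P := tan (c * atan k) / k in (P, k ^+ 2 * P)
  | n'.+1 => let PG := diagPG c k n' in
    let G' := diag_G c n'%:R PG.1 PG.2 in (diag_P k PG.1 G', G')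
  end.

(** The invariant concerns functions on the whole half-line [0 < k], since the bound on [P] passes
    to the next index only through the flow. [inv_PG] replaces [|G| < 1], which can fail at [n = 0],
    where [G = k ^ 2 P]. *)
Record diag_inv c n P G : Prop := {
  inv_dP : forall k, 0 < k -> is_derive k 1 P (odeP c n%:R k (P k) (G k) / k);
  inv_dG : forall k, 0 < k -> is_derive k 1 G (odeG c n%:R k (P k) (G k) / k);
  inv_P : forall k, 0 < k -> `|P k| < 1;
  inv_PG : forall k, 0 < k -> 0 < 1 + P k * G k;
  inv_t : forall k, 0 < k -> `|diag_t c n%:R (P k) (G k)| < 1;
  inv_limP : P @ 0^'+ --> c / (2 * n%:R + 1);
  inv_limG : G @ 0^'+ --> (0 : R)
}.

Lemma cvg_mul_bounded f g (M : R) : (forall k, 0 < k -> `|g k| <= M) ->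
  f @ 0^'+ --> (0 : R) -> (fun k => f k * g k) @ 0^'+ --> (0 : R).
Proof.
move=> gM /cvgrPdist_lt fl; apply/cvgrPdist_lt => e e0.
have M1 : 0 < `|M| + 1 by rewrite ltr_wpDl.
have eM : 0 < e / (`|M| + 1) by rewrite divr_gt0.
have H := fl _ eM.
apply: filterS2 H near0_gt0 => k; rewrite !sub0r !normrN normrM => fk k0.
have := gM k k0; have := ler_norm M => M2 gk.
have : `|f k| * `|g k| <= `|f k| * (`|M| + 1) by rewrite ler_wpM2l //; lra.
move/le_lt_trans; apply.
by rewrite -ltr_pdivlMr.
Qed.

(** [|P| < 1] because [c * atan k] lies strictly between [- atan k] and [atan k]; the limit of [P]
    follows from its own equation by [singular_ode_cvg]. *)
Lemma diag_inv0 c : `|c| < 1 ->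
  diag_inv c 0 (fun k => (diagPG c k 0).1) (fun k => (diagPG c k 0).2).
Proof.
move=> c1; have [ca cb] : -1 < c /\ c < 1 by move: c1; rewrite ltr_norml => /andP.
have at_bnd k : 0 < k -> 0 < atan k < pi / 2.
  move=> k0; rewrite atan_ltpi2 andbT -atan0.
  exact: lt_atan.
have bnd k : 0 < k -> - (pi / 2) < c * atan k < pi / 2.
  by move=> /at_bnd/andP[a0 a1]; apply/andP; split; nra.
have cosn k : 0 < k -> cos (c * atan k) != 0.
  by move=> /bnd H; rewrite gt_eqF // cos_gt0_pihalf.
pose P k := tan (c * atan k) / k.
have dP k : 0 < k -> is_derive k 1 P
    ((- P k + (1 + k ^+ 2 * P k ^+ 2) / (1 + k ^+ 2) * c) / k).
  move=> k0.
  have k2 : 0 < k ^+ 2 by rewrite exprn_gt0.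
  have d1 := is_derive_mul (is_derive_cst c k 1) (is_derive1_atan k).
  have d2 := @is_derive1_comp R tan (fun y =>
    c * atan y) k _ _ (is_derive_tan (cosn k k0)) d1.
  have d3 := is_derive_div d2 (is_derive_id k (1:R)) (lt0r_neq0 k0).
  apply: (is_derive_eq d3).
  rewrite /= cos2_tan2 ?cosn // /P /cst /=; field.
  by rewrite (gt_eqF k0) /= gt_eqF //; lra.
have P1 k : 0 < k -> `|P k| < 1.
  move=> k0; rewrite /P normrM normfV (gtr0_norm k0) ltr_pdivrMr // mul1r.
  have atn : atan k \in `](- (pi / 2)), (pi / 2)[%R.
    by rewrite in_itv /= atan_gtNpi2 atan_ltpi2.
  have catn : c * atan k \in `](- (pi / 2)), (pi / 2)[%R by rewrite in_itv /= bnd.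
  have natn : - atan k \in `](- (pi / 2)), (pi / 2)[%R.
    by rewrite in_itv /= ltrN2 atan_ltpi2 ltrNl atan_gtNpi2.
  have /andP[a0 a1] := at_bnd k k0.
  rewrite ltr_norml -[X in - X < _](atanK k) -[X in _ && (_ < X)](atanK k) -tanN
    !ltr_tan //.
  have ? : 0 < (1 + c) * atan k by rewrite mulr_gt0 //; lra.
  have ? : 0 < (1 - c) * atan k by rewrite mulr_gt0 //; lra.
  by apply/andP; split; lra.
have k2l : (fun k : R => k ^+ 2) @ 0^'+ --> (0:R).
  by have := cvg_sqr (@cvg_id0 R); rewrite expr0n.
have cst (l : R) : (fun=> l) @ (0:R)^'+ --> l by exact: cvg_cst.
have k2P : (fun k : R => k ^+ 2 * P k) @ 0^'+ --> (0:R).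
  by apply: (@cvg_mul_bounded _ _ 1) => // k /P1/ltW.
have Pl : P @ 0^'+ --> c.
  pose B k := c * ((1 + k ^+ 2 * P k ^+ 2) / (1 + k ^+ 2) - 1).
  have Bl : B @ 0^'+ --> (0:R).
    rewrite -[X in _ --> X](mulr0 c); apply: cvgM; first exact: cst.
    rewrite -[X in _ --> X](subrr 1); apply: cvgB; last exact: cst.
    rewrite -[X in _ --> X](divr1 1); apply: cvgM.
      rewrite -[X in _ --> X](addr0 1); apply: cvgD; first exact: cst.
      apply: (@cvg_mul_bounded _ _ 1); last exact: k2l.
      by move=> k /P1 H; rewrite normrX exprn_ile1 // ltW.
    apply: cvgV; first exact: oner_neq0.
    by rewrite -[X in _ --> X](addr0 1); apply: cvgD; [exact: cst|exact: k2l].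
  have Hode k : 0 < k -> is_derive k 1 P (((- 1 + 0) * P k + (c + B k)) / k).
    move=> k0; apply: (is_derive_eq (dP k k0)); rewrite /B.
    by congr (_ / _); ring.
  have H3 : (fun k => k ^+ 1 * (P k - c / 1) ^+ 2) @ 0^'+ --> (0:R).
    apply: (@cvg_mul_bounded _ _ 4).
      move=> k /P1; rewrite ltr_norml divr1 => /andP[? ?].
      by rewrite ger0_norm ?sqr_ge0 //; nra.
    by under eq_fun do rewrite expr1; exact: cvg_id0.
  have N1 : (1%:R : R) <= 2 * 1 - 1 by lra.
  rewrite -[X in _ --> X]divr1.
  exact: (@singular_ode_cvg _ 1 c 1 (fun=> 0) B P ltr01 erefl N1 Hode (cst 0) Bl H3).
split => //=.
- move=> k k0; apply: (is_derive_eq (dP k k0)).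
  by rewrite /odeP mulr0 mul0r subr0.
- move=> k k0; have k2 : 0 < k ^+ 2 by rewrite exprn_gt0.
  apply: (is_derive_eq (is_derive_mul (is_derive_expr 2 (is_derive_id k (1:R))) (dP k
    k0))).
  rewrite /odeG -/(P k) mulr0 !mul0r subr0 /=; field.
  by rewrite (gt_eqF k0) /= gt_eqF //; lra.
- move=> k k0; rewrite -/(P k) mulrCA -expr2 -exprMn.
  by rewrite ltr_pwDl // sqr_ge0.
- by move=> k k0; rewrite /diag_t mul0r subr0 add0r divr1.
- by rewrite mulr0 add0r divr1.
Qed.

Lemma mobius_norm_lt1 (p t : R) : `|p| < 1 -> `|t| < 1 ->
  `|(p - t) / (1 - p * t)| < 1.
Proof.
move=> p1 t1; have d := norm_lt1_mul_lt1 p1 t1.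
rewrite normrM normfV (gtr0_norm d) ltr_pdivrMr // mul1r.
move: p1 t1; rewrite !ltr_norml => /andP[? ?] /andP[? ?].
have ? : 0 < (1 - p) * (1 + t) by rewrite mulr_gt0 //; lra.
have ? : 0 < (1 + p) * (1 - t) by rewrite mulr_gt0 //; lra.
by apply/andP; split; lra.
Qed.

Lemma diag_s_norm_lt1 (p g : R) : `|p| < 1 -> `|g| < 1 -> `|diag_s p g| < 1.
Proof.
move=> p1 g1; have := @mobius_norm_lt1 p (- g) p1.
by rewrite normrN opprK mulrN opprK; apply.
Qed.

Lemma diag_t_norm_lt1 c n (p g : R) : `|c| < 1 -> `|diag_s p g| < 1 ->
  `|diag_t c n%:R p g| < 1.
Proof.
move=> c1; rewrite /diag_t; move: (diag_s p g) => s s1.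
have n0 : (0:R) <= n%:R by rewrite ler0n.
rewrite normrM normfV (@gtr0_norm _ (n%:R + 1)); last by lra.
rewrite ltr_pdivrMr ?mul1r; last by lra.
move: c1 s1; rewrite !ltr_norml => /andP[? ?] /andP[? ?].
by apply/andP; split; nra.
Qed.

(** The bound on [G'] is algebraic. For [P'], the limit [c / (2 n + 3)] places it inside the region
    near 0, and [diag_num_lt_den] keeps it there. *)
Lemma diag_inv_step c n P G : `|c| < 1 -> diag_inv c n P G ->
  let G' k := diag_G c n%:R (P k) (G k) in
  let P' k := diag_P k (P k) (G' k) in
  diag_inv c n.+1 P' G' /\
  (forall k, 0 < k -> `|G' k| < 1 /\ diag_den k (P k) (G' k) != 0).
Proof.
move=> c1 [dP dG P1 PG t1 Pl Gl] G' P'.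
have cst (l : R) : (fun=> l) @ (0:R)^'+ --> l by exact: cvg_cst.
have n0 : (0:R) <= n%:R by rewrite ler0n.
have n1 : n%:R + 1 != 0 :> R by rewrite gt_eqF //; lra.
have [ca cb] : -1 < c /\ c < 1 by move: c1; rewrite ltr_norml => /andP.
have nS : n.+1%:R = n%:R + 1 :> R by rewrite -natr1.
have Gt1 k : 0 < k -> `|G' k| < 1 by move=> k0; apply: mobius_norm_lt1;
  [exact: P1|exact: t1].
have dG' k : 0 < k -> is_derive k 1 G' (odeG' c (n%:R + 1) k (P k) (G' k) / k).
  move=> k0.
  exact: (is_derive_diag_G k0 n0 (dP k k0) (dG k k0) (P1 k k0)
    (lt0r_neq0 (PG k k0)) (t1 k k0)).
have dP' k : 0 < k -> is_derive k 1 P (odeP' c (n%:R + 1) k (P k) (G' k) / k).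
  move=> k0; apply: (is_derive_eq (dP k k0)); rewrite odeP'_eq //.
    by rewrite lt0r_neq0 // expr2 norm_lt1_mul_lt1 ?P1.
  by rewrite lt0r_neq0 // norm_lt1_mul_lt1 ?P1 ?t1.
(* [c / (2 n + 1)] is the fixed point of [p -> (c - n p) / (n + 1)], so [P] and [t] have the same
   limit and [G'] tends to 0. *)
have tl : (fun k => diag_t c n%:R (P k) (G k)) @ 0^'+ --> c / (2 * n%:R + 1).
  set p := c / _ in Pl *.
  have -> : p = (c - n%:R * ((p + 0) / (1 + p * 0))) / (n%:R + 1).
    by rewrite /p; field; rewrite n1 gt_eqF //; lra.
  apply: cvgM; last exact: cst.
  apply: cvgB; first exact: cst.
  apply: cvgM; first exact: cst.
  apply: cvgM; first exact: cvgD.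
  apply: cvgV; first by rewrite mulr0 addr0 oner_neq0.
  by apply: cvgD; [exact: cst|apply: cvgM].
have p1 : c / (2 * n%:R + 1) * (c / (2 * n%:R + 1)) < 1.
  set p := c / _.
  have pe : p * (2 * n%:R + 1) = c by rewrite /p divfK // gt_eqF //; lra.
  by rewrite -expr2 -(expr1n R 2) -subr_gt0 subr_sqr mulr_gt0 //; nra.
have Gl' : G' @ 0^'+ --> (0:R).
  set p := c / _ in Pl tl p1 *.
  rewrite -[X in _ --> X](_ : (p - p) / (1 - p * p) = 0); last by rewrite subrr mul0r.
  apply: cvgM; first exact: cvgB.
  apply: cvgV; first by rewrite gt_eqF // subr_gt0.
  by apply: cvgB; [exact: cst|apply: cvgM].
have Pl2 : P @ 0^'+ --> c / (2 * (n%:R + 1) - 1).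
  by rewrite (_ : 2 * (n%:R + 1) - 1 = 2 * n%:R + 1) //; ring.
have m1 : (1 : R) <= n%:R + 1 by lra.
have [nl dl] := cvg_diag_num_den m1 dG' P1 Gt1 Pl2 Gl'.
have q1 : (c / (2 * (n%:R + 1) + 1)) ^+ 2 < 1.
  set p := c / _.
  have pe : p * (2 * (n%:R + 1) + 1) = c by rewrite /p divfK // gt_eqF //; lra.
  by rewrite -(expr1n R 2) -subr_gt0 subr_sqr mulr_gt0 //; nra.
have near0 : \forall k \near 0^'+,
   diag_num k (P k) (G' k) ^+ 2 < diag_den k (P k) (G' k) ^+ 2.
  have F : (fun k => (diag_den k (P k) (G' k) / k ^+ 2) ^+ 2 -
      (diag_num k (P k) (G' k) / k ^+ 2) ^+ 2) @ 0^'+ -->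
      1 ^+ 2 - (c / (2 * (n%:R + 1) + 1)) ^+ 2.
    by apply: cvgB; apply: cvg_sqr.
  have F0 : 0 < 1 ^+ 2 - (c / (2 * (n%:R + 1) + 1)) ^+ 2 by rewrite expr1n subr_gt0.
  have Hn : \forall k \near 0^'+, 0 < (diag_den k (P k) (G' k) / k ^+ 2) ^+ 2 -
      (diag_num k (P k) (G' k) / k ^+ 2) ^+ 2.
    have /cvgrPdist_lt/(_ _ F0) := F; apply: filterS => k.
    by rewrite ltr_norml => /andP[_]; lra.
  apply: filterS2 near0_gt0 Hn => k k0 /=.
  rewrite !expr_div_n -mulrBl pmulr_lgt0 ?subr_gt0 //.
  by rewrite invr_gt0 !exprn_gt0.
have m0 : (0 : R) <= n%:R + 1 by lra.
have lt := diag_num_lt_den c1 m0 dP' dG' P1 Gt1 near0.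
have den0 k : 0 < k -> diag_den k (P k) (G' k) != 0.
  move=> k0; apply/eqP => H; have := lt k k0.
  by rewrite H expr0n /= ltNge sqr_ge0.
have PG' k : 0 < k -> 1 - P k * G' k != 0.
  by move=> k0; rewrite lt0r_neq0 // norm_lt1_mul_lt1 ?P1 ?Gt1.
have P1' k : 0 < k -> `|P' k| < 1.
  move=> k0; rewrite -(ltr_pXn2r (n:=2)) ?nnegrE //.
  rewrite real_normK ?num_real // expr1n /P' /diag_P expr_div_n ltr_pdivrMr ?mul1r
    ?lt //.
  by rewrite exprn_even_gt0 //= den0.
split; last by move=> k k0; split; [exact: Gt1|exact: den0].
split.
- move=> k k0; rewrite nS.
  exact: is_derive_diag_P k0 (dP' k k0) (dG' k k0) (PG' k k0) (den0 k k0).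
- move=> k k0; have k2 : 0 < k ^+ 2 by rewrite exprn_gt0.
  have G2 := sqr_ge0 (G' k).
  apply: (is_derive_eq (dG' k k0)); rewrite nS odeG'_eq ?PG' ?den0 // gt_eqF //; lra.
- exact: P1'.
- move=> k k0; have := @norm_lt1_mul_lt1 R (P' k) (- G' k) (P1' k k0).
  by rewrite normrN mulrN opprK; apply; exact: Gt1.
- by move=> k k0; apply: diag_t_norm_lt1 => //; apply: diag_s_norm_lt1;
  [exact: P1'|exact: Gt1].
- rewrite nS -[X in _ --> X]divr1.
  have E : \forall k \near (0:R)^'+, (diag_num k (P k) (G' k) / k ^+ 2) /
      (diag_den k (P k) (G' k) / k ^+ 2) = P' k.
    apply: filterS near0_gt0 => k k0; rewrite /P' /diag_P; field.
    by rewrite (gt_eqF k0) den0.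
  apply: (near_eq_cvg_to E); apply: cvgM => //.
  by apply: cvgV => //; exact: oner_neq0.
- exact: Gl'.
Qed.

Lemma diag_inv_all c n : `|c| < 1 ->
  diag_inv c n (fun k => (diagPG c k n).1) (fun k => (diagPG c k n).2).
Proof.
move=> c1; elim: n => [|n IH]; first exact: diag_inv0.
by have [] := diag_inv_step c1 IH.
Qed.

Lemma diagPG_bounds c k n : `|c| < 1 -> 0 < k ->
  let P := (diagPG c k n).1 in let G := (diagPG c k n).2 in
  let G' := (diagPG c k n.+1).2 in
  [/\ `|P| < 1, 0 < 1 + P * G, `|diag_t c n%:R P G| < 1, `|G'| < 1 &
    diag_den k P G' != 0].
Proof.
move=> c1 k0 P G G'; have I := diag_inv_all n c1.
have [_ /(_ k k0) [G1 d]] := diag_inv_step c1 I.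
by split => //; [exact: (inv_P I)|exact: (inv_PG I)|exact: (inv_t I)].
Qed.

End Diag.

(** * The cross-ratio equation and the constraint in terms of [w] *)

Section Hirota.
Context {F : fieldType}.
Implicit Types (a b g : F) (f w : nat -> nat -> F).

(* For the circle pattern [w] is the radius of the circle centered at [f n m]
   when [n + m] is even, and a direction (a number of modulus 1) when [n + m]
   is odd. The cross-ratio equation says exactly that such a [w] exists. *)
Record hirota_lift a b f w : Prop := {
  lift_neq0 : forall n m, w n m != 0;
  lift_h : forall n m, f n.+1 m - f n m = a * (w n m * w n.+1 m);
  lift_v : forall n m, f n m.+1 - f n m = b * (w n m * w n m.+1)
}.

Lemma hirota_lift_transpose a b f w : hirota_lift a b f w ->
  hirota_lift b a (fun n m => f m n) (fun n m => w m n).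
Proof. by case=> w0 lh lv; split. Qed.

(** The increments of [f] around a face add up to 0. *)
Lemma lift_closure a b f w n m : hirota_lift a b f w ->
  w n.+1 m.+1 * (b * w n.+1 m - a * w n m.+1) =
  w n m * (b * w n m.+1 - a * w n.+1 m).
Proof.
move=> [_ lh lv].
have := lh n m; have := lh n m.+1; have := lv n m; have := lv n.+1 m.
move=> E1 E2 E3 E4; apply/eqP; rewrite -subr_eq0.
have <- : (f n.+1 m.+1 - f n.+1 m) - (f n m.+1 - f n m) -
   ((f n.+1 m.+1 - f n m.+1) - (f n.+1 m - f n m)) = 0 by ring.
by rewrite E1 E2 E3 E4; apply/eqP; ring.
Qed.

(** If this factor vanished, so would the one on the other side of [lift_closure], and the two
    linear relations together force [a ^ 2 = b ^ 2]. *)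
Lemma lift_closure_neq0 a b f w n m : a ^+ 2 != b ^+ 2 -> hirota_lift a b f w ->
  b * w n.+1 m - a * w n m.+1 != 0.
Proof.
move=> ab L; apply/eqP => H; have := lift_closure n m L.
rewrite H mulr0 => /esym/eqP; rewrite mulf_eq0 (negbTE (lift_neq0 L n m)) /=.
rewrite subr_eq0 => /eqP H2; move/eqP: H; rewrite subr_eq0 => /eqP H1.
have : (a ^+ 2 - b ^+ 2) * (w n.+1 m * w n m.+1) = 0.
  rewrite (_ : _ * _ = a * w n.+1 m * (a * w n m.+1) -
    b * w n.+1 m * (b * w n m.+1)); last by ring.
  by rewrite H1 H2; ring.
move/eqP; rewrite mulf_eq0 subr_eq0 (negbTE ab) /= mulf_eq0.
by rewrite !(negbTE (lift_neq0 L _ _)).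
Qed.

Lemma lift_closure_SE a b f w n m : hirota_lift a b f w ->
  w n.+1 m * (b * w n.+1 m.+1 + a * w n m) =
  w n m.+1 * (a * w n.+1 m.+1 + b * w n m).
Proof.
move=> L; have H := lift_closure n m L; apply/eqP; rewrite -subr_eq0; apply/eqP.
by rewrite -(subrr (w n m * (b * w n m.+1 - a * w n.+1 m))) -{1}H; ring.
Qed.

Lemma lift_closure_SE_neq0 a b f w n m : a ^+ 2 != b ^+ 2 -> hirota_lift a b f w ->
  b * w n.+1 m.+1 + a * w n m != 0.
Proof.
move=> ab L; apply/eqP => H; have := lift_closure_SE n m L.
rewrite H mulr0 => /esym/eqP; rewrite mulf_eq0 (negbTE (lift_neq0 L n m.+1)) /=.
rewrite addr_eq0 => /eqP H2; move/eqP: H; rewrite addr_eq0 => /eqP H1.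
have : (a ^+ 2 - b ^+ 2) * (w n.+1 m.+1 * w n m) = 0.
  rewrite (_ : _ * _ = a * w n.+1 m.+1 * (a * w n m) -
    b * w n.+1 m.+1 * (b * w n m)); last by ring.
  by rewrite H1 H2; ring.
move/eqP; rewrite mulf_eq0 subr_eq0 (negbTE ab) /= mulf_eq0.
by rewrite !(negbTE (lift_neq0 L _ _)).
Qed.

Definition ratio (x y : F) : F := (x - y) / (x + y).

Definition euler w n m : F :=
  n%:R * ratio (w n.+1 m) (w n.-1 m) + m%:R * ratio (w n m.+1) (w n m.-1).

(** The constraint after substitution of the lift: [(f_E - f) (f - f_W) / (f_E - f_W)] becomes
    [a w w_E w_W / (w_E + w_W)]. *)
Record constrained a b g f w : Prop := {
  cst_n : forall n m, (0 < n)%N -> w n.+1 m + w n.-1 m != 0;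
  cst_m : forall n m, (0 < m)%N -> w n m.+1 + w n m.-1 != 0;
  cst_eq : forall n m, g * f n m =
    a * (2 * n%:R * (w n m * (w n.+1 m * w n.-1 m / (w n.+1 m + w n.-1 m)))) +
    b * (2 * m%:R * (w n m * (w n m.+1 * w n m.-1 / (w n m.+1 + w n m.-1))))
}.

Lemma constrained_transpose a b g f w : constrained a b g f w ->
  constrained b a g (fun n m => f m n) (fun n m => w m n).
Proof.
by move=> [cn cm ce]; split=> [n m|n m|n m]; [exact: cm|exact: cn|rewrite ce addrC].
Qed.

Lemma euler_transpose w n m : euler (fun n m => w m n) n m = euler w m n.
Proof. by rewrite /euler addrC. Qed.

(** Closure of the two faces between the columns expresses the upper and lower values of the right
    column through the other four; what remains is a rational identity. *)
Lemma vertical_difference a b f w n m : a ^+ 2 != b ^+ 2 -> hirota_lift a b f w ->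
  w n m.+2 + w n m != 0 -> w n.+1 m.+2 + w n.+1 m != 0 ->
  b * (2 * (w n.+1 m.+1 * (w n.+1 m.+2 * w n.+1 m / (w n.+1 m.+2 + w n.+1 m)))
     - 2 * (w n m.+1 * (w n m.+2 * w n m / (w n m.+2 + w n m)))) =
  a * (w n m.+1 * w n.+1 m.+1) *
    (ratio (w n.+1 m.+2) (w n.+1 m) + ratio (w n m.+2) (w n m)).
Proof.
move=> ab L H1 H2.
have := lift_closure n m.+1 L; have D1 := lift_closure_neq0 n m.+1 ab L.
have := lift_closure_SE n m L; have D2 := lift_closure_SE_neq0 n m ab L.
move: H1 H2 D1 D2; rewrite /ratio.
move: (w n m) (w n m.+1) (w n m.+2) (w n.+1 m) (w n.+1 m.+1) (w n.+1 m.+2).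
move=> S w0 N SE E NE H1 H2 D1 D2 E1 E2.
have NEe : NE = w0 * (b * N - a * E) / (b * E - a * N) by rewrite -E2 mulfK.
have SEe : SE = w0 * (a * E + b * S) / (b * E + a * S) by rewrite -E1 mulfK.
(* This factorization turns [NE + SE != 0] into the nonvanishing of each factor, as [field]
   requires. *)
have sumE : NE + SE = w0 * (b ^+ 2 - a ^+ 2) * E * (N + S) / ((b * E -
  a * N) * (b * E + a * S)).
  by rewrite NEe SEe; field; rewrite D1 D2.
have H3 : w0 * (b ^+ 2 - a ^+ 2) * E * (N + S) != 0.
  by move: H2; rewrite sumE; apply: contraNN => /eqP ->; rewrite mul0r.
move: H3; rewrite !mulf_eq0 !negb_or => /andP[/andP[/andP[w00 ba0] E0] _].
rewrite sumE NEe SEe; field.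
by rewrite D1 D2 H1 E0 ba0 w00.
Qed.

(** Subtract the constraints at two horizontal neighbours and divide by [f n.+1 m - f n m = a w w'];
    the vertical terms are handled by [vertical_difference]. *)
Lemma euler_step a b g f w n m : a != 0 -> a ^+ 2 != b ^+ 2 ->
  hirota_lift a b f w -> constrained a b g f w ->
  euler w n m + euler w n.+1 m = g - 1.
Proof.
move=> a0 ab L [cn cm ce].
have := lift_h L n m.
move/(congr1 (fun x => g * x)); rewrite mulrBr !ce.
have Hv : b * (2 * m%:R * (w n.+1 m * (w n.+1 m.+1 * w n.+1 m.-1 / (w n.+1 m.+1 +
  w n.+1 m.-1)))) -
   b * (2 * m%:R * (w n m * (w n m.+1 * w n m.-1 / (w n m.+1 + w n m.-1)))) =
   a * (w n m * w n.+1 m) * (m%:R * (ratio (w n.+1 m.+1) (w n.+1 m.-1) +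
     ratio (w n m.+1) (w n m.-1))).
  case: m => [|m]; first by rewrite !mulr0 !mul0r !mulr0 subrr.
  have := vertical_difference ab L (cm n m.+1 erefl) (cm n.+1 m.+1 erefl).
  move/(congr1 (fun x => m.+1%:R * x)) => Hd.
  by apply: etrans (etrans Hd _); rewrite /=; ring.
have Hh1 : 2 * n%:R * (w n m * (w n.+1 m * w n.-1 m / (w n.+1 m + w n.-1 m))) =
   (w n m * w n.+1 m) * (n%:R * (1 - ratio (w n.+1 m) (w n.-1 m))).
  case: n {Hv} => [|n]; first by rewrite !mulr0 !mul0r !mulr0.
  by rewrite /ratio; field; exact: (cn n.+1 m erefl).
have Hh2 : 2 * n.+1%:R * (w n.+1 m * (w n.+2 m * w n m / (w n.+2 m + w n m))) =
   (w n m * w n.+1 m) * (n.+1%:R * (1 + ratio (w n.+2 m) (w n m))).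
  by rewrite /ratio; field; exact: (cn n.+1 m erefl).
rewrite [n.+1.-1]/= Hh1 Hh2 opprD addrACA Hv => H.
have W0 : a * (w n m * w n.+1 m) != 0.
  by rewrite !mulf_neq0 ?(lift_neq0 L).
apply: (mulfI W0); rewrite mulrBr mulr1 [_ * g]mulrC -H /euler /= -natr1.
by ring.
Qed.

(** [euler] vanishes at the origin and its values at neighbours add up to [g - 1], so it alternates;
    on the first column [euler_step] is used transposed. *)
Lemma euler_val a b g f w : a != 0 -> b != 0 -> a ^+ 2 != b ^+ 2 ->
  hirota_lift a b f w -> constrained a b g f w ->
  forall n m, euler w n m = if odd (n + m) then g - 1 else 0.
Proof.
move=> a0 b0 ab L C.
have E0 m : euler w 0 m = if odd m then g - 1 else 0.
  elim: m => [|m IH]; first by rewrite /euler !mul0r addr0.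
  have ba : b ^+ 2 != a ^+ 2 by rewrite eq_sym.
  have := euler_step m 0 b0 ba (hirota_lift_transpose L) (constrained_transpose C).
  rewrite (euler_transpose w m 0) (euler_transpose w m.+1 0) IH => /esym; rewrite /=;
    case: (odd m) => /=.
    by rewrite -[LHS]addr0 => /addrI <-.
  by rewrite add0r => ->.
elim=> [|n IH] m; first exact: E0.
have := euler_step n m a0 ab L C.
rewrite IH => /esym; rewrite addSn /=; case: (odd (n + m)) => /=.
  by rewrite -[LHS]addr0 => /addrI <-.
by rewrite add0r => ->.
Qed.

(** [w] is built along the bottom row and then up each column; the horizontal relation propagates
    upwards by the cross-ratio equation. *)
Lemma hirota_lift_exists a b f : a != 0 -> b != 0 ->
  (forall n m, f n.+1 m - f n m != 0) -> (forall n m, f n m.+1 - f n m != 0) ->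
  (forall n m, b ^+ 2 * ((f n.+1 m - f n m) * (f n.+1 m.+1 - f n m.+1)) =
     a ^+ 2 * ((f n.+1 m.+1 - f n.+1 m) * (f n m.+1 - f n m))) ->
  exists2 w, hirota_lift a b f w & w 0 0 = 1.
Proof.
move=> a0 b0 h0 v0 cr.
pose row := fix row n := if n is n'.+1 then (f n'.+1 0%N -
  f n' 0%N) / (a * row n') else 1.
pose w n := fix col m := if m is m'.+1 then (f n m'.+1 -
  f n m') / (b * col m') else row n.
have row0 n : row n != 0.
  by elim: n => [|n IH] /=; rewrite ?oner_neq0 // mulf_neq0 ?h0 // invr_neq0 //
    mulf_neq0.
have w0 n m : w n m != 0.
  by elim: m => [|m IH] /=; rewrite ?row0 // mulf_neq0 ?v0 // invr_neq0 // mulf_neq0.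
have wv n m : f n m.+1 - f n m = b * (w n m * w n m.+1).
  by rewrite /= -/(w n m); field; rewrite b0 w0.
exists w => //; split => // n m; elim: m => [|m IH].
  by rewrite /=; field; rewrite a0 row0.
have := cr n m; rewrite !wv IH => /eqP; rewrite -subr_eq0.
set h := f n.+1 m.+1 - f n m.+1; move=> H.
have {H} : (a * b ^+ 2 * (w n m * w n.+1 m)) * (h - a * (w n m.+1 * w n.+1 m.+1)) == 0.
  by move: H; congr (_ == 0); ring.
by rewrite !mulf_eq0 (negbTE a0) (negbTE b0) !(negbTE (w0 _ _)) /= subr_eq0 => /eqP.
Qed.

End Hirota.

Section Expi.
Context {R : realType}.
Implicit Types (s t : R).

Lemma expiD s t : expi (s + t) = expi s * expi t :> R[i].
Proof. by rewrite /expi cosD sinD; simpc; rewrite addrC (addrC (cos s * _)). Qed.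

Lemma expi0 : expi 0 = 1 :> R[i].
Proof. by rewrite /expi cos0 sin0. Qed.

Lemma expi_neq0 t : expi t != 0 :> R[i].
Proof.
apply/eqP => H; have := expiD t (- t); rewrite subrr expi0 H mul0r.
by move/eqP; rewrite oner_eq0.
Qed.

Lemma expiN t : expi (- t) = (expi t)^-1 :> R[i].
Proof.
apply: (mulfI (expi_neq0 t)); rewrite -expiD subrr expi0 divff //.
exact: expi_neq0.
Qed.

Lemma expi_conj t : (expi t)^* = (expi t)^-1 :> R[i].
Proof. by rewrite -expiN /expi cosN sinN. Qed.

Lemma expi_conj_mul t : expi t * (expi t)^* = 1 :> R[i].
Proof. by rewrite expi_conj divff // expi_neq0. Qed.

Lemma expi_sqr_neq1 t : 0 < t -> t < pi -> expi t ^+ 2 != 1 :> R[i].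
Proof.
move=> t0 tpi; rewrite expr2 -expiD /expi eq_complex /= negb_and.
have st : sin t != 0 by rewrite gt_eqF // sin_gt0_pi // t0.
apply/orP; left; rewrite cosD -!expr2 -subr_eq0.
have -> : cos t ^+ 2 - sin t ^+ 2 - 1 = - (2 * sin t ^+ 2).
  by rewrite -[X in _ - X = _](cos2Dsin2 t); ring.
by rewrite oppr_eq0 mulf_neq0 // expf_neq0.
Qed.

Lemma tan_half_gt0 t : 0 < t -> t < pi -> 0 < tan (t / 2).
Proof.
move=> t0 tpi; rewrite /tan divr_gt0 //.
  by rewrite sin_gt0_pihalf //; lra.
by rewrite cos_gt0_pihalf //; lra.
Qed.

Lemma cos_half_neq0 t : - pi < t -> t < pi -> cos (t / 2) != 0.
Proof. by move=> ? ?; rewrite gt_eqF // cos_gt0_pihalf //; lra. Qed.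

Lemma expi_tan t : - pi < t -> t < pi ->
  expi t * (1 - 'i * (tan (t / 2))%:C) = 1 + 'i * (tan (t / 2))%:C.
Proof.
move=> t0 tpi; have c0 := cos_half_neq0 t0 tpi.
have ts : sin (t / 2) = tan (t / 2) * cos (t / 2) by rewrite /tan divfK.
have E := cos2Dsin2 (t / 2).
have ht : t = t / 2 + t / 2 by lra.
rewrite {1}ht /expi cosD sinD; simpc; move: ts E.
move: (tan _) (cos _) (sin _) => a b d -> E.
congr (_ +i* _).
  by apply: etrans E; ring.
by rewrite -[RHS]mulr1 -E; ring.
Qed.

End Expi.

(** * Reality of the radii and unimodularity of the directions *)

Section Reality.
Context {R : realType}.
Implicit Types (e z : R[i]) (f w : nat -> nat -> R[i]) (c : R).

(** Conjugation inverts [e], [z2] and [z3], and [(e z3 - z2) / (e z2 - z3)] is invariant under this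
    inversion. *)
Lemma real_step e z1 z2 z3 z4 : e * e^* = 1 ->
  z1^* = z1 -> z2 * z2^* = 1 -> z3 * z3^* = 1 -> e * z2 - z3 != 0 ->
  z4 * (e * z2 - z3) = z1 * (e * z3 - z2) -> z4^* = z4.
Proof.
move=> ee r1 u2 u3 D /(canRL (mulfK D)) ->.
have e0 : e != 0 by apply/eqP => H; move: ee; rewrite H mul0r => /esym/eqP;
  rewrite oner_eq0.
have z20 : z2 != 0 by apply/eqP => H; move: u2; rewrite H mul0r => /esym/eqP;
  rewrite oner_eq0.
have z30 : z3 != 0 by apply/eqP => H; move: u3; rewrite H mul0r => /esym/eqP;
  rewrite oner_eq0.
have inv (x : R[i]) : x != 0 -> x * x^* = 1 -> x^* = x^-1.
  by move=> x0 H; apply: (mulfI x0); rewrite H divff.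
rewrite !rmorphM fmorphV !rmorphB !rmorphM /= r1 (inv e) // (inv z2) // (inv z3) //.
field; rewrite e0 z20 z30 D /=.
rewrite (_ : z3 + -1 * (e * z2) = - (e * z2 - z3)); last by ring.
by rewrite oppr_eq0.
Qed.

(** For real [z2], [z3] and [|e| = 1], the numbers [e z2 - z3] and [e z3 - z2] have the same
    modulus. *)
Lemma unimod_step e z1 z2 z3 z4 : e * e^* = 1 ->
  z1 * z1^* = 1 -> z2^* = z2 -> z3^* = z3 -> e * z2 - z3 != 0 ->
  z4 * (e * z2 - z3) = z1 * (e * z3 - z2) -> z4 * z4^* = 1.
Proof.
move=> ee u1 r2 r3 D H.
have D' : e^* * z2 - z3 != 0.
  have : (e * z2 - z3)^* != 0 by rewrite conjc_eq0.
  by rewrite rmorphB rmorphM /= r2 r3.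
have := congr1 (fun z => z^*) H; rewrite /= !rmorphM !rmorphB !rmorphM /= r2 r3 => H'.
have e0 : e != 0 by apply/eqP => He; move: ee; rewrite He mul0r => /esym/eqP;
  rewrite oner_eq0.
apply: (mulIf (mulf_neq0 D D')).
rewrite mul1r mulrACA H H' mulrACA u1 mul1r.
have ei : e^* = e^-1 by apply: (mulfI e0); rewrite ee divff.
by rewrite ei; field.
Qed.

Lemma axis_step (a : nat -> R[i]) (x : R) n : a n.+2 + a n != 0 ->
  n.+1%:R * ratio (a n.+2) (a n) = x%:C -> `|x| < 1 ->
  a n.+2 = ((n.+1%:R + x) / (n.+1%:R - x))%:C * a n.
Proof.
rewrite ltr_norml => S0 E /andP[x1 x2].
have n1 : (1 : R) <= n.+1%:R by rewrite ler1n.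
have D : n.+1%:R - x%:C != 0 :> R[i].
  rewrite -(rmorph_nat (real_complex R)) -rmorphB /= eq_complex /= eqxx andbT.
  by rewrite gt_eqF //; lra.
rewrite rmorphM fmorphV rmorphD rmorphB /= !(rmorph_nat (real_complex R)).
apply: (mulfI D); rewrite mulrA mulrCA divff // mulr1 -E /ratio; field.
exact: S0.
Qed.

(** On an axis the Euler equation has a single term: it fixes the values at odd places and
    multiplies those at even places by positive factors. *)
Lemma axis_values (a : nat -> R[i]) c : `|c| < 1 ->
  (forall n, a n.+2 + a n != 0) ->
  (forall n, n.+1%:R * ratio (a n.+2) (a n) = if odd n.+1 then c%:C else 0) ->
  a 0%N = 1 -> forall n, if odd n then a n = a 1%N else 0 < a n.
Proof.
move=> c1 S0 E a0; elim/ltn_ind => -[_|[//|n]].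
  by rewrite /= a0 ltr01.
move=> /(_ n (leqnSn _)) /=; rewrite negbK.
have := E n; rewrite /=; case: ifPn => /= on En IH.
  rewrite (negbTE on) in IH.
  have n1 : (1 : R) <= n.+1%:R by rewrite ler1n.
  have := c1; rewrite ltr_norml => /andP[c2 c3].
  rewrite (negbTE on) (axis_step (S0 n) En c1) mulr_gt0 // (ltcR 0) divr_gt0 //; lra.
rewrite negbK in on; rewrite on in IH *.
have := axis_step (S0 n) En; rewrite normr0 ltr01 => /(_ erefl) ->.
by rewrite addr0 subr0 divff ?mul1r // pnatr_eq0.
Qed.

(** [e] and [c] stand for [e^(i alpha)] and [gamma - 1]. *)
Record zpattern e c w : Prop := {
  zp_neq0 : forall n m, w n m != 0;
  zp_closure : forall n m, w n.+1 m.+1 * (e * w n.+1 m - w n m.+1) =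
                           w n m * (e * w n m.+1 - w n.+1 m);
  zp_closure_neq0 : forall n m, e * w n.+1 m - w n m.+1 != 0;
  zp_euler : forall n m, euler w n m = if odd (n + m) then c%:C else 0;
  zp_sum_n : forall n m, w n.+2 m + w n m != 0;
  zp_sum_m : forall n m, w n m.+2 + w n m != 0;
  zp_00 : w 0%N 0%N = 1;
  zp_10 : w 1%N 0%N = 1;
  zp_01 : w 0%N 1%N * (w 0%N 1%N)^* = 1
}.

(** The axes are covered by [axis_values]; closure carries the alternation to the fourth vertex of
    each face. *)
Lemma zpattern_reality e c w : e * e^* = 1 -> `|c| < 1 -> zpattern e c w ->
  forall n m, if odd (n + m) then w n m * (w n m)^* = 1 else (w n m)^* = w n m.
Proof.
move=> ee c1 Z.
have pr (z : R[i]) : 0 < z -> z^* = z.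
  case: z => x y; rewrite ltcE => /andP[/= /eqP -> _]. by simpc.
have R0 n : if odd n then w n 0%N * (w n 0%N)^* = 1 else (w n 0%N)^* = w n 0%N.
  have E k : k.+1%:R * ratio (w k.+2 0%N) (w k 0%N) = if odd k.+1 then c%:C else 0.
    by have := zp_euler Z k.+1 0%N; rewrite /euler mul0r addr0 addn0.
  have := axis_values c1 (fun n => zp_sum_n Z n 0%N) E (zp_00 Z) n.
  by case: (odd n) => [->|]; [rewrite (zp_10 Z) mul1r rmorph1|exact: pr].
have C0 m : if odd m then w 0%N m * (w 0%N m)^* = 1 else (w 0%N m)^* = w 0%N m.
  have E k : k.+1%:R * ratio (w 0%N k.+2) (w 0%N k) = if odd k.+1 then c%:C else 0.
    by have := zp_euler Z 0%N k.+1; rewrite /euler mul0r add0r add0n.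
  have := axis_values c1 (fun m => zp_sum_m Z 0%N m) E (zp_00 Z) m.
  by case: (odd m) => [->|]; [exact: (zp_01 Z)|exact: pr].
elim=> [|n IH] m; first exact: C0.
elim: m => [|m IHm]; first by rewrite addn0; exact: R0.
have H0 := IH m; have H1 := IH m.+1; rewrite addnS /= in H1.
rewrite addSn /= in IHm; rewrite addSn addnS /= negbK.
have cl := zp_closure Z n m; have D := zp_closure_neq0 Z n m.
case: (odd (n + m)) H0 H1 IHm => /= H0 H1 IHm.
  exact: (unimod_step ee H0 IHm H1 D cl).
exact: (real_step ee H0 IHm H1 D cl).
Qed.

End Reality.

(** * Kites along the diagonal and positivity of the radii *)

Section Kites.
Context {F : fieldType}.
Implicit Types (x e u v : F).

(* Here and below [x] stands for [i k], so that [e = (1 + x) / (1 - x)]. *)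
Lemma even_kite x e P uE uN V W : 2 * x != 0 -> 1 - x != 0 -> 1 - x * P != 0 ->
  e * (1 - x) = 1 + x -> uE != 0 -> uN * (1 - x * P) = uE * (1 + x * P) ->
  W * (e * uE - uN) = V * (e * uN - uE) -> W * (1 - P) = V * (1 + P).
Proof.
move=> x0 D1 D2 He u0 Hu H.
have D : 2 * x * uE != 0 by rewrite mulf_neq0.
apply: (mulfI D).
transitivity (W * (e * uE - uN) * ((1 - x) * (1 - x * P))).
  rewrite (_ : W * (e * uE - uN) * _ =
     W * (uE * (e * (1 - x)) * (1 - x * P) - uN * (1 - x * P) * (1 - x))); last by ring.
  by rewrite He Hu; ring.
rewrite H.
rewrite (_ : V * (e * uN - uE) * _ =
   V * (uN * (1 - x * P) * (e * (1 - x)) - uE * (1 - x) * (1 - x * P))); last by ring.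
by rewrite He Hu; ring.
Qed.

(** Dual to [even_kite]: the relative difference of the two radii of a face prescribes the turn
    between its two directions. *)
Lemma odd_kite x e G uE uE' E N : 2 != 0 :> F -> 1 - x != 0 -> 1 + G != 0 -> N != 0 ->
  e * (1 - x) = 1 + x -> E * (1 + G) = N * (1 - G) ->
  uE' * (e * E - N) = uE * (e * N - E) -> uE' * (x - G) = uE * (x + G).
Proof.
move=> two D1 D2 N0 He HE H.
have D : 2 * N != 0 by rewrite mulf_neq0.
apply: (mulfI D).
transitivity (uE' * (e * E - N) * ((1 - x) * (1 + G))).
  rewrite (_ : uE' * (e * E - N) * _ =
     uE' * (e * (1 - x) * (E * (1 + G)) - N * (1 - x) * (1 + G))); last by ring.
  by rewrite He HE; ring.
rewrite H.
rewrite (_ : uE * (e * N - E) * _ =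
   uE * (e * (1 - x) * N * (1 + G) - E * (1 + G) * (1 - x))); last by ring.
by rewrite He HE; ring.
Qed.

(** [uN' / uE' = (uN / uE) (uE / uE') ^ 2]. With [x ^ 2 = - k ^ 2], [den] and [num] are [diag_den]
    and [diag_num]. *)
Lemma diagonal_turn x P G uE uN uE' uN' : uE' != 0 ->
  uN * (1 - x * P) = uE * (1 + x * P) -> uE' * (x - G) = uE * (x + G) ->
  uE' * uN' = uE * uN ->
  let den := - x ^+ 2 - G ^+ 2 + 2 * x ^+ 2 * P * G in
  let num := P * (- x ^+ 2 - G ^+ 2) + 2 * G in
  uN' * (den - x * num) = uE' * (den + x * num).
Proof.
move=> u0 H1 H2 H3 den num; apply: (mulfI u0).
have -> : den - x * num = - ((1 - x * P) * (x + G) ^+ 2) by rewrite /den /num; ring.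
have -> : den + x * num = - ((1 + x * P) * (x - G) ^+ 2) by rewrite /den /num; ring.
transitivity (- (uE * (x + G)) ^+ 2 * (1 + x * P)).
  rewrite mulrA H3 (_ : uE * uN * _ = - uE * (x + G) ^+ 2 * (uN * (1 - x * P)));
    last by ring.
  by rewrite H1; ring.
by rewrite -H2; ring.
Qed.

End Kites.

Section RealRatios.
Context {R : realType}.
Implicit Types (c P G : R) (n : nat).

(** From [ratio N V = P] and [ratio V S = G] one gets [ratio N S = diag_s P G]; the Euler equation
    gives [ratio E V = diag_t], and subtraction gives [ratio N E = diag_G]. *)
Lemma diag_next_radius c n P G V N S E : `|P| < 1 -> 1 + P * G != 0 ->
  `|diag_t c n%:R P G| < 1 -> 0 < V -> N * (1 - P) = V * (1 + P) ->
  ((0 < n)%N -> 1 + G != 0 /\ S * (1 + G) = V * (1 - G)) -> E + V != 0 ->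
  n.+1%:R * ratio E V + n%:R * ratio N S = c ->
  E * (1 + diag_G c n%:R P G) = N * (1 - diag_G c n%:R P G).
Proof.
move=> P1 PG t1 V0 HN HS EV Heq.
have [Pa Pb] : -1 < P /\ P < 1 by move: P1; rewrite ltr_norml => /andP.
have P0 : 1 - P != 0 by rewrite gt_eqF //; lra.
have V0' : V != 0 by rewrite gt_eqF.
have NE : N = V * (1 + P) / (1 - P) by rewrite -HN mulfK.
have ns : n%:R * ratio N S = n%:R * diag_s P G.
  case: n HS Heq t1 => [|n] HS _ _; first by rewrite !mul0r.
  have [G0 HS'] := HS erefl.
  have SE : S = V * (1 - G) / (1 + G) by rewrite -HS' mulfK.
  rewrite NE SE /ratio /diag_s; field; rewrite PG P0 G0 /=.
  rewrite (_ : V * (1 + P) * (1 + G) + _ = 2 * V * (1 + P * G)); last by ring.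
  have two : 2 != 0 :> R by rewrite pnatr_eq0.
  by rewrite mulf_neq0 ?mulf_neq0.
have nS : n.+1%:R = n%:R + 1 :> R by rewrite -natr1.
have n1 : n%:R + 1 != 0 :> R by rewrite -nS pnatr_eq0.
have tE : ratio E V = diag_t c n%:R P G.
  by rewrite /diag_t -ns -Heq nS; field.
have {}tE : E * (1 - diag_t c n%:R P G) = V * (1 + diag_t c n%:R P G).
  by rewrite -tE /ratio; field.
rewrite /diag_G; move: tE t1; move: (diag_t c n%:R P G) => t tE t1.
have D := norm_lt1_mul_lt1 P1 t1.
have [ta tb] : -1 < t /\ t < 1 by move: t1; rewrite ltr_norml => /andP.
have t0 : 1 - t != 0 by rewrite gt_eqF //; lra.
have EE : E = V * (1 + t) / (1 - t) by rewrite -tE mulfK.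
by rewrite EE NE; field; rewrite t0 P0 gt_eqF.
Qed.

(* Marching away from the diagonal: as [l < j], the relative difference
   [ratio E W] that the equation prescribes has absolute value less than 1. *)
Lemma ratio_pos_step c j l (E W N S : R) : `|c| < 1 -> (l < j)%N ->
  0 < W -> 0 < N -> ((0 < l)%N -> 0 < S) -> E + W != 0 ->
  j%:R * ratio E W + l%:R * ratio N S = c -> 0 < E.
Proof.
move=> c1 lj W0 N0 S0 EW Heq.
have lj' : l%:R + 1 <= j%:R :> R by rewrite natr1 ler_nat.
have l0 : (0:R) <= l%:R by rewrite ler0n.
have j0 : 0 < j%:R :> R by lra.
have [ca cb] : -1 < c /\ c < 1 by move: c1; rewrite ltr_norml => /andP.
have [sa sb] : - l%:R <= l%:R * ratio N S /\ l%:R * ratio N S <= l%:R.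
  case: l {lj lj' Heq} l0 S0 => [|l] l0 S0; first by rewrite mul0r oppr0.
  have Sp := S0 erefl.
  have rp : ratio N S * (N + S) = N - S by rewrite /ratio divfK // gt_eqF // addr_gt0.
  have [ra rb] : -1 <= ratio N S /\ ratio N S <= 1.
    by split; rewrite -(ler_pM2r (addr_gt0 N0 Sp)) rp; lra.
  by split; nra.
move: Heq; set t := ratio E W => Heq.
have tE : t * (E + W) = E - W by rewrite /t /ratio divfK.
have t1 : t < 1 by rewrite -(ltr_pM2l j0); lra.
have t2 : -1 < t by rewrite -(ltr_pM2l j0); lra.
have : 0 < E * (1 - t).
  rewrite (_ : E * (1 - t) = W * (1 + t)); last by nra.
  by rewrite mulr_gt0 //; lra.
by rewrite pmulr_lgt0 //; lra.
Qed.

End RealRatios.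

Section Positivity.
Context {R : realType}.
Implicit Types (c k : R) (w : nat -> nat -> R[i]).

Lemma one_sub_i_neq0 (y : R) : 1 - 'i * y%:C != 0 :> R[i].
Proof. by simpc; rewrite eq_complex /= oner_eq0. Qed.

Lemma sqr_i_mul (y : R) : ('i * y%:C) ^+ 2 = - (y ^+ 2)%:C :> R[i].
Proof. by rewrite exprMn sqrCi mulN1r rmorphXn. Qed.

Lemma diag_turn_real (k P G : R) (u v : R[i]) : diag_den k P G != 0 ->
  let x := 'i * k%:C in
  let den := - x ^+ 2 - G%:C ^+ 2 + 2 * x ^+ 2 * P%:C * G%:C in
  let num := P%:C * (- x ^+ 2 - G%:C ^+ 2) + 2 * G%:C in
  v * (den - x * num) = u * (den + x * num) ->
  v * (1 - x * (diag_P k P G)%:C) = u * (1 + x * (diag_P k P G)%:C).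
Proof.
move=> d0 x den num.
have dC : (diag_den k P G)%:C != 0 by rewrite eq_complex /= eqxx andbT.
have -> : den = (diag_den k P G)%:C.
  rewrite /den /x sqr_i_mul /diag_den !expr2 !rmorphB !rmorphM /= rmorph_nat.
  by ring.
have -> : num = (diag_num k P G)%:C.
  rewrite /num /x sqr_i_mul /diag_num !expr2 rmorphD !rmorphM rmorphB !rmorphM /=.
  by rewrite rmorph_nat; ring.
move=> H; apply: (mulIf dC); rewrite /diag_P rmorphM fmorphV /=.
have E : (diag_den k P G)%:C^-1 * (diag_den k P G)%:C = 1 by rewrite mulVf.
move: H E; move: (diag_den k P G)%:C (diag_num k P G)%:C => d nm H E.
have -> : v * (1 - x * (nm * d^-1)) * d = v * (d - x * nm * (d^-1 * d)) by ring.
have -> : u * (1 + x * (nm * d^-1)) * d = u * (d + x * nm * (d^-1 * d)) by ring.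
by rewrite E !mulr1.
Qed.

Lemma ratio_real (y z : R) : ratio y%:C z%:C = (ratio y z)%:C.
Proof. by rewrite /ratio rmorphM fmorphV rmorphB rmorphD. Qed.

Lemma zpattern_Re e c w n m : e * e^* = 1 -> `|c| < 1 -> zpattern e c w ->
  ~~ odd (n + m) -> w n m = (complex.Re (w n m))%:C.
Proof.
move=> ee c1 Z o; have := zpattern_reality ee c1 Z n m; rewrite (negbTE o).
case: (w n m) => x y /eqP; rewrite eq_complex /= eqxx /= => /eqP y0.
have -> : y = 0 by lra.
by [].
Qed.

Lemma zpattern_real_euler e c w n m : e * e^* = 1 -> `|c| < 1 -> zpattern e c w ->
  ~~ odd (n + m) ->
  n.+1%:R * ratio (complex.Re (w n.+2 m)) (complex.Re (w n m)) +
  m%:R * ratio (complex.Re (w n.+1 m.+1)) (complex.Re (w n.+1 m.-1)) = c.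
Proof.
move=> ee c1 Z o; apply: complexI.
have := zp_euler Z n.+1 m; rewrite addSn /= o => <-; rewrite /euler /=.
rewrite rmorphD; congr (_ + _); rewrite rmorphM /= rmorph_nat.
  by rewrite -ratio_real -!(zpattern_Re ee c1 Z) //; move: o; rewrite ?(addSn,
    addnS) /= ?negbK.
case: m o => [|m] o; first by rewrite !mul0r.
by rewrite -ratio_real -!(zpattern_Re ee c1 Z) //; move: o; rewrite ?(addSn,
  addnS) /= ?negbK.
Qed.

Lemma zpattern_real_euler_sym e c w n m : e * e^* = 1 -> `|c| < 1 -> zpattern e c w ->
  ~~ odd (n + m) ->
  m.+1%:R * ratio (complex.Re (w n m.+2)) (complex.Re (w n m)) +
  n%:R * ratio (complex.Re (w n.+1 m.+1)) (complex.Re (w n.-1 m.+1)) = c.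
Proof.
move=> ee c1 Z o; apply: complexI.
have := zp_euler Z n m.+1; rewrite addnS /= o => <-; rewrite /euler /= addrC.
rewrite rmorphD; congr (_ + _); rewrite rmorphM /= rmorph_nat.
  case: n o => [|n] o; first by rewrite !mul0r.
  by rewrite -ratio_real -!(zpattern_Re ee c1 Z) //; move: o; rewrite ?(addSn,
    addnS) /= ?negbK.
by rewrite -ratio_real -!(zpattern_Re ee c1 Z) //; move: o; rewrite ?(addSn,
  addnS) /= ?negbK.
Qed.

Lemma zpattern_Re_sum_n e c w n m : e * e^* = 1 -> `|c| < 1 -> zpattern e c w ->
  ~~ odd (n + m) -> complex.Re (w n.+2 m) + complex.Re (w n m) != 0.
Proof.
move=> ee c1 Z o; have := zp_sum_n Z n m.
rewrite (zpattern_Re ee c1 Z o) (@zpattern_Re _ c w n.+2 m ee c1 Z) /= ?negbK //.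
by rewrite -rmorphD /= eq_complex /= eqxx andbT.
Qed.

Lemma zpattern_Re_sum_m e c w n m : e * e^* = 1 -> `|c| < 1 -> zpattern e c w ->
  ~~ odd (n + m) -> complex.Re (w n m.+2) + complex.Re (w n m) != 0.
Proof.
move=> ee c1 Z o; have := zp_sum_m Z n m.
rewrite (zpattern_Re ee c1 Z o) (@zpattern_Re _ c w n m.+2 ee c1 Z) ?addnS /= ?negbK //.
by rewrite -rmorphD /= eq_complex /= eqxx andbT.
Qed.

(** [P_n] measures the turn between the directions on both sides of the diagonal. In the induction,
    [even_kite] gives the next diagonal radius, the Euler equation gives [G_(n+1)], and [odd_kite]
    with [diagonal_turn] gives the next turn. *)
Lemma zpattern_diagonal (alpha : R) c w n : 0 < alpha -> alpha < pi -> `|c| < 1 ->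
  zpattern (expi alpha) c w -> w 0%N 1%N = expi (c * alpha) ->
  let k := tan (alpha / 2) in let PG := diagPG c k n in
  [/\ 0 < complex.Re (w n n),
      w n n.+1 * (1 - 'i * k%:C * (PG.1)%:C) = w n.+1 n * (1 + 'i * k%:C * (PG.1)%:C) &
      (0 < n)%N -> complex.Re (w n.+1 n.-1) * (1 + PG.2) = complex.Re (w n n) * (1 -
        PG.2)].
Proof.
move=> a0 api c1 Z w01 k.
have ee := expi_conj_mul alpha.
have apiN : - pi < alpha by lra.
have k0 : 0 < k by exact: tan_half_gt0.
have kC : k%:C != 0 by rewrite eq_complex /= eqxx andbT gt_eqF.
have He : expi alpha * (1 - 'i * k%:C) = 1 + 'i * k%:C by exact: expi_tan.
have iC : 'i != 0 :> R[i] by exact: neq0Ci.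
have two : 2 != 0 :> R[i] by rewrite pnatr_eq0.
have PC (y : R) : 1 - 'i * k%:C * y%:C != 0 :> R[i].
  by rewrite -mulrA -rmorphM one_sub_i_neq0.
have next m : let P := (diagPG c k m).1 in
    w m m.+1 * (1 - 'i * k%:C * P%:C) = w m.+1 m * (1 + 'i * k%:C * P%:C) ->
    complex.Re (w m.+1 m.+1) * (1 - P) = complex.Re (w m m) * (1 + P).
  move=> P H; apply: complexI; rewrite !rmorphM rmorphB rmorphD rmorph1 /=.
  rewrite -!(zpattern_Re ee c1 Z) ?addnn ?addSn ?addnS /= ?negbK ?addnn ?odd_double //.
  apply: (@even_kite _ ('i * k%:C) (expi alpha) _ (w m.+1 m) (w m m.+1)) => //.
  - by rewrite !mulf_neq0.
  - exact: one_sub_i_neq0.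
  - exact: (zp_neq0 Z).
  - exact: (zp_closure Z).
have Gne m : (0 < m)%N -> 1 + (diagPG c k m).2 != 0.
  case: m => // m _; have [_ _ _ + _] := diagPG_bounds m c1 k0.
  by rewrite ltr_norml => /andP[? ?]; rewrite gt_eqF //; lra.
elim: n => [|n [IHr IHz IHs]].
  split => //=; first by rewrite (zp_00 Z).
  (* Since [alpha = 2 atan k], the initial [k P_0] is [tan (c alpha / 2)], which matches the turn
     [e^(i c alpha)]. *)
  rewrite (zp_10 Z) mul1r w01 -!(mulrA 'i) -!rmorphM /=.
  have at0 : atan k = alpha / 2 by rewrite /k tanK // in_itv /=; apply/andP; split; lra.
  have -> : k * (tan (c * atan k) / k) = tan (c * alpha / 2).
    by rewrite at0 mulrCA divff ?gt_eqF // mulr1 mulrA.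
  have [ca cb] : -1 < c /\ c < 1 by move: c1; rewrite ltr_norml => /andP.
  by rewrite expi_tan //; nra.
have [P1 PG t1 G1 den0] := diagPG_bounds n c1 k0.
move: IHz IHs P1 PG t1 G1 den0; set P := (diagPG c k n).1; set G := (diagPG c k n).2.
set G' := (diagPG c k n.+1).2 => IHz IHs P1 PG t1 G1 den0.
have Nr := next n IHz; rewrite -/P in Nr.
have P2 : 0 < 1 - P /\ 0 < 1 + P by move: P1; rewrite ltr_norml => /andP[? ?]; split;
  lra.
have N0 : 0 < complex.Re (w n.+1 n.+1).
  have : 0 < complex.Re (w n.+1 n.+1) * (1 - P) by rewrite Nr mulr_gt0 //; case: P2.
  by rewrite pmulr_lgt0 //; case: P2.
have odd0 : ~~ odd (n + n) by rewrite addnn odd_double.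
have HE : complex.Re (w n.+2 n) * (1 + G') = complex.Re (w n.+1 n.+1) * (1 - G').
  apply: (@diag_next_radius _ c n P G (complex.Re (w n n)) _ (complex.Re (w n.+1
    n.-1))) => //.
  - by rewrite gt_eqF.
  - by move=> n0; split; [exact: Gne|exact: IHs].
  - exact: (zpattern_Re_sum_n ee c1 Z odd0).
  - exact: (zpattern_real_euler ee c1 Z odd0).
have G1' : 1 + G' != 0 by exact: (Gne n.+1).
split => //.
have turn : w n.+2 n.+1 * ('i * k%:C - G'%:C) = w n.+1 n * ('i * k%:C + G'%:C).
  apply: (@odd_kite _ ('i * k%:C) (expi alpha) _ _ _ (w n.+2 n) (w n.+1 n.+1)) => //.
  - exact: one_sub_i_neq0.
  - by rewrite -(rmorph1 (real_complex R)) -rmorphD /= eq_complex /= eqxx andbT.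
  - exact: (zp_neq0 Z).
  - rewrite (@zpattern_Re _ c w n.+2 n ee c1 Z) /= ?negbK // (@zpattern_Re _ c w n.+1
    n.+1 ee c1 Z) ?addSn ?addnS /= ?negbK //.
    by rewrite -(rmorph1 (real_complex R)) -rmorphD -rmorphB -!rmorphM /= HE.
  - exact: (zp_closure Z n.+1 n).
(* At a diagonal vertex the two coefficients of the Euler equation agree and its right side is 0, so
   the two ratios are opposite; this is an equality of products. *)
have cons : w n.+2 n.+1 * w n.+1 n.+2 = w n.+1 n * w n n.+1.
  have := zp_euler Z n.+1 n.+1; rewrite addSn addnS /= negbK (negbTE odd0) /euler /=
    -mulrDr.
  move/eqP; rewrite mulf_eq0 pnatr_eq0 /= /ratio => /eqP.
  have s1 := zp_sum_n Z n n.+1; have s2 := zp_sum_m Z n.+1 n.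
  move=> H; apply/eqP; rewrite -subr_eq0; apply/eqP.
  have D : 2 != 0 :> R[i] by [].
  apply: (mulfI D); rewrite mulr0.
  transitivity (((w n.+2 n.+1 - w n n.+1) / (w n.+2 n.+1 + w n n.+1) +
     (w n.+1 n.+2 - w n.+1 n) / (w n.+1 n.+2 + w n.+1 n)) *
     ((w n.+2 n.+1 + w n n.+1) * (w n.+1 n.+2 + w n.+1 n))).
    by field; rewrite s1 s2.
  by rewrite H mul0r.
have := diagonal_turn (zp_neq0 Z n.+2 n.+1) IHz turn cons.
exact: (diag_turn_real den0).
Qed.

(** From the diagonal, [ratio_pos_step] spreads positivity to both sides. *)
Lemma zpattern_positive (alpha : R) c w : 0 < alpha -> alpha < pi -> `|c| < 1 ->
  zpattern (expi alpha) c w -> w 0%N 1%N = expi (c * alpha) ->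
  forall n m, ~~ odd (n + m) -> 0 < complex.Re (w n m).
Proof.
move=> a0 api c1 Z w01; have ee := expi_conj_mul alpha.
have diag n : 0 < complex.Re (w n n).
  by have [] := zpattern_diagonal n a0 api c1 Z w01.
have par p j : ~~ odd ((p + j.*2) + p) by rewrite addnAC addnn oddD !odd_double.
(* The vertex [(p + 2 j, p)] has coordinate sum [2 d]. Its western and southern inputs lie on the
   preceding even antidiagonal, the northern one on the same antidiagonal but nearer to [n = m]. *)
have below d : forall p j, (p + j = d)%N -> 0 < complex.Re (w (p + j.*2)%N p).
  elim/ltn_ind: d => d IHd p j; elim: j p => [|j IHj] p pjd; first by rewrite addn0.
  have dS : d = (p + j).+1 by rewrite -pjd addnS.
  rewrite doubleS !addnS.
  apply: (@ratio_pos_step _ c (p + j.*2).+1 p _ (complex.Re (w (p + j.*2)%N p))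
      (complex.Re (w (p + j.*2).+1 p.+1)) (complex.Re (w (p + j.*2).+1 p.-1))) => //.
  - by rewrite ltnS leq_addr.
  - by apply: (IHd (p + j)%N) => //; rewrite dS.
  - by rewrite -addSn; apply: IHj; rewrite addSn dS.
  - case: p pjd dS => // p pjd dS _ /=.
    have -> : (p.+1 + j.*2).+1 = (p + j.+1.*2)%N by rewrite doubleS !addnS addSn.
    by apply: (IHd (p + j.+1)%N) => //; rewrite dS addnS addSn.
  - exact: (zpattern_Re_sum_n ee c1 Z).
  - exact: (zpattern_real_euler ee c1 Z).
have above d : forall p j, (p + j = d)%N -> 0 < complex.Re (w p (p + j.*2)%N).
  elim/ltn_ind: d => d IHd p j; elim: j p => [|j IHj] p pjd; first by rewrite addn0.
  have dS : d = (p + j).+1 by rewrite -pjd addnS.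
  rewrite doubleS !addnS.
  apply: (@ratio_pos_step _ c (p + j.*2).+1 p _ (complex.Re (w p (p + j.*2)%N))
      (complex.Re (w p.+1 (p + j.*2).+1)) (complex.Re (w p.-1 (p + j.*2).+1))) => //.
  - by rewrite ltnS leq_addr.
  - by apply: (IHd (p + j)%N) => //; rewrite dS.
  - by rewrite -addSn; apply: IHj; rewrite addSn dS.
  - case: p pjd dS => // p pjd dS _ /=.
    have -> : (p.+1 + j.*2).+1 = (p + j.+1.*2)%N by rewrite doubleS !addnS addSn.
    by apply: (IHd (p + j.+1)%N) => //; rewrite dS addnS addSn.
  - by apply: (zpattern_Re_sum_m ee c1 Z); rewrite addnC.
  - by apply: (zpattern_real_euler_sym ee c1 Z); rewrite addnC.
have half p q : (p <= q)%N -> ~~ odd (p + q) -> q = (p + ((q - p)./2).*2)%N.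
  move=> pq o; rewrite -[X in (p + X)%N](_ : (q - p)%N = _) ?subnKC //.
  by rewrite -[LHS]odd_double_half oddB // addbC -oddD (negbTE o).
move=> n m o; case: (leqP n m) => nm.
  by rewrite (half _ _ nm o); exact: above.
rewrite addnC in o; rewrite (half _ _ (ltnW nm) o); exact: below.
Qed.

End Positivity.

(** * From the discrete map to the pattern [w] *)

Section Link.
Context {R : realType}.
Implicit Types (alpha gamma : R) (f w : nat -> nat -> R[i]).

(** As [x / 0 = 0], a nonzero cross-ratio forces all edges of the face to be nonzero. *)
Lemma cross_ratio_edges f n m (q : R[i]) : q != 0 -> cross_ratio f n m = q ->
  [/\ f n.+1 m - f n m != 0, f n m.+1 - f n m != 0 &
   (f n.+1 m - f n m) * (f n.+1 m.+1 - f n m.+1) =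
   q * ((f n.+1 m.+1 - f n.+1 m) * (f n m.+1 - f n m))].
Proof.
have -> : cross_ratio f n m = (f n.+1 m - f n m) * (f n.+1 m.+1 - f n m.+1) /
    ((f n.+1 m.+1 - f n.+1 m) * (f n m.+1 - f n m)).
  rewrite /cross_ratio -(opprB (f n.+1 m) (f n m)).
  by rewrite -(opprB (f n.+1 m.+1) (f n.+1 m)) !mulNr invrN mulrN opprK.
move: (_ - _) (_ - _) (_ - _) (_ - _) => h0 h1 v1 v0 q0 E; move: q0.
rewrite -E !mulf_eq0 invr_eq0 !mulf_eq0 !negb_or =>
  /andP[/andP[h00 h10] /andP[v10 v00]].
by split => //; rewrite divfK // mulf_neq0.
Qed.

(** With [a = 1] and [b = e^(i alpha)] the cross-ratio is [a ^ 2 / b ^ 2]. The constraint at the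
    origin gives [f 0 0 = 0], so the normalization [w 0 0 = 1] and the initial data determine
    [w 1 0] and [w 0 1]. *)
Lemma discrete_Zgamma_zpattern alpha gamma f :
  0 < alpha -> alpha < pi -> 0 < gamma -> discrete_Zgamma alpha gamma f ->
  exists w, [/\ hirota_lift 1 (expi alpha) f w,
    constrained 1 (expi alpha) gamma%:C f w,
    zpattern (expi alpha) (gamma - 1) w,
    w 0%N 1%N = expi ((gamma - 1) * alpha) & f 0%N 0%N = 0].
Proof.
move=> a0 api g0 [cr dn dm dc f10 f01].
set e := expi alpha.
have e0 : e != 0 by exact: expi_neq0.
have e2 : expi (- (2 * alpha)) = (e ^+ 2)^-1 :> R[i].
  by rewrite expiN mulr_natl mulr2n expiD -expr2.
have gC : gamma%:C != 0 by rewrite eq_complex /= eqxx andbT gt_eqF.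
have q0 : expi (- (2 * alpha)) != 0 :> R[i] by exact: expi_neq0.
have f00 : f 0%N 0%N = 0.
  have := dc 0%N 0%N; rewrite /constraint_rhs !mulr0 !mul0r addr0 => /eqP.
  by rewrite mulf_eq0 (negbTE gC) => /eqP.
have [w L w00] : exists2 w, hirota_lift 1 e f w & w 0%N 0%N = 1.
  apply: (hirota_lift_exists (oner_neq0 _) e0) => n m.
  - by have [] := cross_ratio_edges q0 (cr n m).
  - by have [] := cross_ratio_edges q0 (cr n m).
  - have [_ _ ->] := cross_ratio_edges q0 (cr n m).
    by rewrite e2 expr1n mul1r mulVKf // expf_neq0.
have hh n m : f n.+2 m - f n m = w n.+1 m * (w n.+2 m + w n m).
  rewrite (_ : f n.+2 m - f n m = (f n.+2 m - f n.+1 m) + (f n.+1 m - f n m));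
    last by ring.
  by rewrite !(lift_h L); ring.
have vv n m : f n m.+2 - f n m = e * (w n m.+1 * (w n m.+2 + w n m)).
  rewrite (_ : f n m.+2 - f n m = (f n m.+2 - f n m.+1) + (f n m.+1 - f n m));
    last by ring.
  by rewrite !(lift_v L); ring.
have sn n m : w n.+2 m + w n m != 0.
  have := dn n.+1 m erefl; rewrite hh; apply: contraNN => /eqP ->.
  by rewrite mulr0.
have sm n m : w n m.+2 + w n m != 0.
  have := dm n m.+1 erefl; rewrite vv; apply: contraNN => /eqP ->.
  by rewrite !mulr0.
have C : constrained 1 e gamma%:C f w.
  split=> [[|n] m|n [|m]|n m] //.
  rewrite dc /constraint_rhs; congr (_ + _).
    case: n => [|n]; first by rewrite !mulr0 !mul0r !mulr0.
    rewrite /= hh !(lift_h L) !mul1r; field.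
    by rewrite sn (lift_neq0 L).
  case: m => [|m]; first by rewrite !mulr0 !mul0r !mulr0.
  rewrite /= vv !(lift_v L); field.
  by rewrite sm (lift_neq0 L) e0.
have w01 : w 0%N 1%N = expi ((gamma - 1) * alpha).
  have := lift_v L 0%N 0%N; rewrite f01 f00 w00 subr0 mul1r => E.
  apply: (mulfI e0); rewrite -E -expiD; congr expi; ring.
have ab : 1 ^+ 2 != e ^+ 2 by rewrite expr1n eq_sym expi_sqr_neq1.
exists w; split => //; split => //.
- exact: (lift_neq0 L).
- by move=> n m; have := lift_closure n m L; rewrite !mul1r.
- by move=> n m; have := lift_closure_neq0 n m ab L; rewrite !mul1r.
- move=> n m; rewrite (euler_val (oner_neq0 _) e0 ab L C).
  by rewrite rmorphB rmorph1.
- by have := lift_h L 0%N 0%N; rewrite f10 f00 w00 subr0 !mul1r.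
- by rewrite w01 expi_conj_mul.
Qed.

End Link.

(** * Crossing numbers *)

Section Crossing.
Context {R : realType}.
Implicit Types (x y d : R) (a b c p q z : R[i]).

Definition det a b : R := complex.Re a * complex.Im b - complex.Im a * complex.Re b.

(* Signed crossing, by an oriented edge, of the ray from a point [z] in the
   direction [d]: [x] and [y] are the determinants of [d] with the ends of the
   edge, and the sign of the last argument tells on which side of the edge [z]
   lies. *)
Definition crossing x y d : int :=
  [&& x < 0, 0 <= y & 0 < d]%:Z - [&& y < 0, 0 <= x & d < 0]%:Z.

Lemma crossing_rev x y d : crossing y x (- d) = - crossing x y d.
Proof. by rewrite /crossing oppr_gt0 oppr_lt0 opprB. Qed.

(** The hypotheses express positive orientation and the fact that the [x] come from a linear form
    vanishing at the start of the ray; they exclude every sign pattern with a negative count. *)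
Lemma crossing_triangle_ge0 x1 x2 x3 d12 d23 d31 :
  0 < d12 + d23 + d31 -> x1 * d23 + x2 * d31 + x3 * d12 = 0 ->
  0 <= crossing x1 x2 d12 + crossing x2 x3 d23 + crossing x3 x1 d31.
Proof.
move=> D E; rewrite /crossing.
case: (ltP x1 0) => h1; case: (ltP x2 0) => h2; case: (ltP x3 0) => h3 //=;
case: (ltgtP d12 0) => h12 //=; case: (ltgtP d23 0) => h23 //=;
case: (ltgtP d31 0) => h31 //=; exfalso; nra.
Qed.

(** Only upward passages count here, and the relation with positive weights makes the [x] take both
    signs, so the cycle rises through 0 exactly once. *)
Lemma crossing_triangle_inside x1 x2 x3 d12 d23 d31 :
  0 < d12 -> 0 < d23 -> 0 < d31 -> x1 * d23 + x2 * d31 + x3 * d12 = 0 ->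
  [|| x1 != 0, x2 != 0 | x3 != 0] ->
  crossing x1 x2 d12 + crossing x2 x3 d23 + crossing x3 x1 d31 = 1.
Proof.
move=> D12 D23 D31 E; rewrite /crossing.
rewrite (lt_gtF D12) (lt_gtF D23) (lt_gtF D31) D12 D23 D31 !andbT !andbF.
case: (ltgtP x1 0) => h1; case: (ltgtP x2 0) => h2; case: (ltgtP x3 0) => h3 //=;
  move=> _; exfalso; nra.
Qed.

(** Here the ray starts on the diagonal [p s]. Either [xp] and [xs] have opposite signs and one of
    the two paths between [p] and [s] rises through 0, or both vanish and a vertex [q] or [t] below
    the ray supplies the passage. *)
Lemma crossing_diagonal xp xq xs xt dpq dqs dst dtp :
  0 < dpq -> 0 < dqs -> 0 < dst -> 0 < dtp ->
  xp * dqs + xs * dpq = 0 -> xp * dst + xs * dtp = 0 ->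
  (xp = 0 -> xs = 0 -> (xq < 0) || (xt < 0)) ->
  1 <= crossing xp xq dpq + crossing xq xs dqs + crossing xs xt dst +
    crossing xt xp dtp.
Proof.
move=> Dpq Dqs Dst Dtp E1 E2; rewrite /crossing.
rewrite (lt_gtF Dpq) (lt_gtF Dqs) (lt_gtF Dst) (lt_gtF Dtp) Dpq Dqs Dst Dtp !andbT
  !andbF.
case: (ltgtP xp 0) => hp; case: (ltgtP xs 0) => hs; first [by exfalso; nra | idtac];
case: (ltP xq 0) => hq; case: (ltP xt 0) => ht //= H; by have := H hp hs.
Qed.

(* The signs assumed here and in the next lemma prevent the triangle from
   enclosing the origin. *)
Lemma crossing_origin_np x1 x2 x3 d12 d23 d31 :
  x1 * d23 + x2 * d31 + x3 * d12 = 0 -> 0 < d23 ->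
  d12 < 0 \/ d12 = 0 /\ d31 < 0 ->
  crossing x1 x2 d12 + crossing x2 x3 d23 + crossing x3 x1 d31 = 0.
Proof.
move=> E D23 H; rewrite /crossing (lt_gtF D23) D23 !andbT !andbF.
case: H => [h|[h h']];
case: (ltP x1 0) => h1; case: (ltP x2 0) => h2; case: (ltP x3 0) => h3 //=;
case: (ltgtP d12 0) => h12 //=; case: (ltgtP d31 0) => h31 //=; exfalso; nra.
Qed.

Lemma crossing_origin_pn x1 x2 x3 d12 d23 d31 :
  x1 * d23 + x2 * d31 + x3 * d12 = 0 -> 0 < d12 ->
  d23 < 0 \/ d23 = 0 /\ d31 < 0 ->
  crossing x1 x2 d12 + crossing x2 x3 d23 + crossing x3 x1 d31 = 0.
Proof.
move=> E D12 H; rewrite /crossing (lt_gtF D12) D12 !andbT !andbF.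
case: H => [h|[h h']];
case: (ltP x1 0) => h1; case: (ltP x2 0) => h2; case: (ltP x3 0) => h3 //=;
case: (ltgtP d23 0) => h23 //=; case: (ltgtP d31 0) => h31 //=; exfalso; nra.
Qed.

Lemma crossing_le_up x y d : crossing x y d <= ((x < 0) && (0 <= y))%:Z.
Proof.
by rewrite /crossing; case: (x < 0); case: (0 <= y); case: (0 < d); case: (y < 0);
  case: (0 <= x); case: (d < 0).
Qed.

Lemma crossing_pos x y d : 0 < d -> crossing x y d = ((x < 0) && (0 <= y))%:Z.
Proof. by move=> d0; rewrite /crossing d0 (lt_gtF d0) !andbF andbT subr0. Qed.

Lemma crossing0 x y : crossing x y 0 = 0.
Proof. by rewrite /crossing ltxx !andbF. Qed.

Lemma crossing_same_ray (l t1 t2 s : R) : 0 <= s -> 0 <= t1 -> t1 < t2 ->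
  crossing (t1 * l) (t2 * l) (- (s * (t2 * l - t1 * l))) = 0.
Proof.
move=> s0 t10 t12; rewrite /crossing.
(* Only [l < 0] with [t1 = 0] could give a passage, a downward one, and there the third argument of
   [crossing] is nonnegative. *)
case: (ltgtP l 0) => [l0|l0|->]; last by rewrite !mulr0 ltxx.
  have E : (- (s * (t2 * l - t1 * l)) < 0) = false.
    by apply/negbTE; rewrite -leNgt -mulrBl oppr_ge0 mulr_ge0_le0 // mulr_ge0_le0 //;
      lra.
  rewrite E !andbF subr0; case: (ltP (t1 * l) 0) => //= H1.
  by case: (lerP 0 (t2 * l)) => //= H2; exfalso; nra.
have H1 : (t1 * l < 0) = false by apply/negbTE; rewrite -leNgt; nra.
have H2 : (t2 * l < 0) = false by apply/negbTE; rewrite -leNgt; nra.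
by rewrite H1 H2.
Qed.

Lemma det_eq0 (v a b : R[i]) : det v a = 0 -> det v b = 0 -> det a b != 0 -> v = 0.
Proof.
case: v a b => [vx vy] [ax ay] [bx by_]; rewrite /det /= => H1 H2 H3.
have X : vx * (ax * by_ - ay * bx) = 0.
  rewrite (_ : _ * _ = ax * (vx * by_ - vy * bx) - bx * (vx * ay - vy * ax));
    last by ring.
  by rewrite H1 H2; ring.
have Y : vy * (ax * by_ - ay * bx) = 0.
  rewrite (_ : _ * _ = ay * (vx * by_ - vy * bx) - by_ * (vx * ay - vy * ax));
    last by ring.
  by rewrite H1 H2; ring.
move/eqP: X; rewrite mulf_eq0 (negbTE H3) orbF => /eqP ->.
by move/eqP: Y; rewrite mulf_eq0 (negbTE H3) orbF => /eqP ->.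
Qed.

End Crossing.

Section Winding.
Context {R : realType}.
Implicit Types (a b c d p q z : R[i]) (s : R) (f : nat -> nat -> R[i]).

Definition side a b z : R := det (b - a) (z - a).

(* The ray starts at [s%:C * d], and [det d a] is also the determinant of [d] with
   the vector from that point to [a]. *)
Definition chi d s a b : int := crossing (det d a) (det d b) (side a b (s%:C * d)).
Definition chi0 d a b : int := crossing (det d a) (det d b) (det a b).

Lemma detN a b : det b a = - det a b.
Proof. by rewrite /det; ring. Qed.

Lemma side_rev a b z : side b a z = - side a b z.
Proof.
by case: a b z => [ax ay] [bx by_] [zx zy]; rewrite /side /det /=; ring.
Qed.

Lemma side_ray d s a b : side a b (s%:C * d) = det a b - s * (det d b - det d a).
Proof.
by case: a b d => [ax ay] [bx by_] [dx dy]; rewrite /side /det /=; ring.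
Qed.

Lemma side_sum a b c z : side a b z + side b c z + side c a z = side a b c.
Proof.
by case: a b c z => [ax ay] [bx by_] [cx cy] [zx zy]; rewrite /side /det /=; ring.
Qed.

(** The three [side] factors are proportional to the barycentric coordinates of [z], and
    [det d z = 0]. *)
Lemma side_plucker d s a b c : let z := s%:C * d in
  det d a * side b c z + det d b * side c a z + det d c * side a b z = 0.
Proof.
by case: a b c d => [ax ay] [bx by_] [cx cy] [dx dy]; rewrite /side /det /=; ring.
Qed.

Lemma det_plucker d a b c :
  det d a * det b c + det d b * det c a + det d c * det a b = 0.
Proof. by rewrite /det; ring. Qed.

Lemma chi_rev d s a b : chi d s b a = - chi d s a b.
Proof. by rewrite /chi (side_rev a b) crossing_rev. Qed.

Lemma chi0_rev d a b : chi0 d b a = - chi0 d a b.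
Proof. by rewrite /chi0 (detN a b) crossing_rev. Qed.

Lemma chi_triangle_ge0 d s a b c : 0 < side a b c ->
  0 <= chi d s a b + chi d s b c + chi d s c a.
Proof.
move=> D; apply: crossing_triangle_ge0; last exact: side_plucker.
by rewrite side_sum.
Qed.

Lemma chi_triangle_inside d s a b c : d != 0 -> let z := s%:C * d in
  0 < side a b z -> 0 < side b c z -> 0 < side c a z ->
  chi d s a b + chi d s b c + chi d s c a = 1.
Proof.
move=> d0 z H1 H2 H3.
apply: crossing_triangle_inside => //; first exact: side_plucker.
apply: contraNT d0; rewrite !negb_or !negbK => /and3P[/eqP Ha /eqP Hb /eqP Hc].
apply/eqP; apply: (@det_eq0 _ d (b - a) (c - a)).
- by move: Ha Hb; rewrite /det; case: (a) (b) (d) => [??] [??] [??] /=; lra.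
- by move: Ha Hc; rewrite /det; case: (a) (c) (d) => [??] [??] [??] /=; lra.
- by rewrite gt_eqF // -/(side a b c) -(side_sum a b c z); lra.
Qed.

Lemma chi_quad_ge0 d s p q r t : 0 < side p q r -> 0 < side p r t ->
  0 <= chi d s p q + chi d s q r + chi d s r t + chi d s t p.
Proof.
move=> H1 H2; have := chi_triangle_ge0 d s H1; have := chi_triangle_ge0 d s H2.
by rewrite (chi_rev d s p r); lia.
Qed.

(** A point inside one triangle is counted once there and at least 0 times by the other; a point of
    the diagonal lies inside neither and needs [crossing_diagonal]. *)
Lemma chi_quad_inside d s p q r t : d != 0 -> 0 < side p q r -> 0 < side p r t ->
  let z := s%:C * d in
  [\/ [/\ 0 < side p q z, 0 < side q r z & 0 < side r p z],
      [/\ 0 < side p r z, 0 < side r t z & 0 < side t p z] |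
      [/\ side p r z = 0, 0 < side p q z /\ 0 < side q r z &
          0 < side r t z /\ 0 < side t p z]] ->
  1 <= chi d s p q + chi d s q r + chi d s r t + chi d s t p.
Proof.
move=> d0 H1 H2 z.
have G1 := chi_triangle_ge0 d s H1; have G2 := chi_triangle_ge0 d s H2.
have rv := chi_rev d s p r.
case=> [[a1 a2 a3]|[a1 a2 a3]|[a0 [a1 a2] [a3 a4]]].
- by have := chi_triangle_inside d0 a1 a2 a3; lia.
- by have := chi_triangle_inside d0 a1 a2 a3; lia.
have a0' : side r p z = 0 by rewrite side_rev a0 oppr0.
apply: crossing_diagonal => //.
- by have := side_plucker d s p q r; rewrite /= -/z a0' mulr0 addr0.
- by have := side_plucker d s p r t; rewrite /= -/z a0 mulr0 addr0.
move=> xp xr; apply: contraNT d0; rewrite negb_or -!leNgt => /andP[xq xt].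
(* Here [p] and [r] lie on the line spanned by [d], and [q], [t] are on opposite sides of it; if
   neither is below, [q] lies on it too and [p q r] degenerates. *)
have E : det d q * side p r t = - (det d t * side p q r).
  apply/eqP; rewrite -addr_eq0; apply/eqP; move: xp xr; rewrite /side /det.
  case: (p) (q) (r) (t) (d) => [px py] [qx qy] [rx ry] [tx ty] [dx dy] /= xp xr.
  have -> : (dx * qy - dy * qx) * ((rx - px) * (ty - py) - (ry - py) * (tx - px)) +
    (dx * ty - dy * tx) * ((qx - px) * (ry - py) - (qy - py) * (rx - px)) =
    (dx * ry - dy * rx) * ((qx - px) * (ty - py) - (qy - py) * (tx - px))
   + (dx * py - dy * px) * ((rx - px) * (ty - py) - (ry - py) * (tx - px)
      + (qx - px) * (ry - py) - (qy - py) * (rx - px) - (qx - px) * (ty - py) + (qy -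
        py) * (tx - px)) by ring.
  by rewrite xp xr !mul0r addr0.
have q0 : det d q = 0 by nra.
apply/eqP; apply: (@det_eq0 _ d (q - p) (r - p)).
- by move: xp q0; rewrite /det; case: (p) (q) (d) => [??] [??] [??] /=; lra.
- by move: xp xr; rewrite /det; case: (p) (r) (d) => [??] [??] [??] /=; lra.
- by rewrite gt_eqF.
Qed.

End Winding.

Section Mesh.
Context {R : realType}.
Implicit Types (a b d p q z : R[i]) (s : R) (f : nat -> nat -> R[i]) (n m K : nat).

Definition quad_sum (c : R[i] -> R[i] -> int) f n m : int :=
  c (f n m) (f n.+1 m) + c (f n.+1 m) (f n.+1 m.+1) +
  c (f n.+1 m.+1) (f n m.+1) + c (f n m.+1) (f n m).

(** Discrete Stokes formula: inner edges are traversed in both directions and telescope away. *)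
Lemma grid_sum (c : R[i] -> R[i] -> int) f K : (forall a b, c b a = - c a b) ->
  \sum_(0 <= n < K) \sum_(0 <= m < K) quad_sum c f n m =
  \sum_(0 <= n < K) c (f n 0%N) (f n.+1 0%N) +
  \sum_(0 <= m < K) c (f K m) (f K m.+1) +
  \sum_(0 <= n < K) c (f n.+1 K) (f n K) -
  \sum_(0 <= m < K) c (f 0%N m) (f 0%N m.+1).
Proof.
move=> rv.
pose H n m := c (f n m) (f n.+1 m); pose V n m := c (f n m) (f n m.+1).
have E n m : quad_sum c f n m = (V n.+1 m - V n m) - (H n m.+1 - H n m).
  by rewrite /quad_sum (rv (f n m.+1) (f n.+1 m.+1)) (rv (f n m) (f n m.+1)) /H /V; lia.
under eq_bigr => n _ do under eq_bigr => m _ do rewrite E.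
under eq_bigr => n _ do rewrite sumrB telescope_sumr //.
rewrite sumrB exchange_big /=.
under eq_bigr => m _ do rewrite telescope_sumr //.
rewrite !sumrB.
have -> : \sum_(0 <= n < K) c (f n.+1 K) (f n K) = - \sum_(0 <= n < K) H n K.
  by rewrite -sumrN; apply: eq_bigr => n _; rewrite rv.
rewrite -/(H _ _) /V /H; ring.
Qed.

(** * Winding numbers of grids with monotone argument *)

Record polar_mesh f : Prop := {
  mesh_axis_n : exists d (t : nat -> R), [/\ t 0%N = 0,
    forall n, t n < t n.+1 & forall n, f n 0%N = (t n)%:C * d];
  mesh_axis_m : exists d (t : nat -> R), [/\ t 0%N = 0,
    forall m, t m < t m.+1 & forall m, f 0%N m = (t m)%:C * d];
  mesh_v : forall n m, (0 < n)%N -> 0 < det (f n m) (f n m.+1);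
  mesh_h : forall n m, (0 < m)%N -> det (f n m) (f n.+1 m) < 0;
  (* Both triangles of one of the two diagonal splittings are positively
     oriented. *)
  mesh_tri : forall n m,
    (0 < side (f n m) (f n.+1 m) (f n.+1 m.+1) /\
     0 < side (f n m) (f n.+1 m.+1) (f n m.+1)) \/
    (0 < side (f n.+1 m) (f n.+1 m.+1) (f n m.+1) /\
     0 < side (f n.+1 m) (f n m.+1) (f n m))
}.

Lemma increasing_pos (t : nat -> R) : t 0%N = 0 -> (forall n, t n < t n.+1) ->
  (forall n, 0 <= t n) /\ (forall n, 0 < t n.+1).
Proof.
move=> t0 ti; have H n : 0 <= t n.
  by elim: n => [|n IH]; [rewrite t0|rewrite (le_trans IH) // ltW].
by split => // n; exact: le_lt_trans (H n) (ti n).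
Qed.

Lemma det_scale_l (x : R) a b : det (x%:C * a) b = x * det a b.
Proof. by case: a b => [??] [??]; rewrite /det /=; ring. Qed.

Lemma det_scale_r (x : R) a b : det a (x%:C * b) = x * det a b.
Proof. by case: a b => [??] [??]; rewrite /det /=; ring. Qed.

Lemma det_self a : det a a = 0.
Proof. by rewrite /det; ring. Qed.

Lemma chi_axis d s v (t : nat -> R) n : 0 <= s ->
  t 0%N = 0 -> (forall n, t n < t n.+1) ->
  chi d s ((t n)%:C * v) ((t n.+1)%:C * v) = 0.
Proof.
move=> s0 t0 ti; have [tp _] := increasing_pos t0 ti.
rewrite /chi side_ray.
by rewrite !det_scale_l !det_scale_r det_self !mulr0 sub0r; apply: crossing_same_ray.
Qed.

Lemma chi0_axis d v (x y : R) : chi0 d (x%:C * v) (y%:C * v) = 0.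
Proof.
by rewrite /chi0 !det_scale_l !det_scale_r det_self !mulr0 crossing0.
Qed.

(** Seen from the origin such an edge counts at every upward passage, the most that any starting
    point can yield. *)
Lemma chi_le_chi0 d s a b : 0 < det a b -> chi d s a b <= chi0 d a b.
Proof. by move=> ab; rewrite /chi0 crossing_pos // crossing_le_up. Qed.

(** These faces do not enclose the origin: a diagonal cuts each into two triangles with edges of
    opposite sign as seen from there. On an axis one edge has sign 0 and the diagonal decides. *)
Lemma quad_sum_chi0 f d n m : polar_mesh f -> (0 < n + m)%N ->
  quad_sum (chi0 d) f n m = 0.
Proof.
move=> M nm; rewrite /quad_sum.
have BC := mesh_v M m (ltn0Sn n).
have CD : 0 < det (f n.+1 m.+1) (f n m.+1).
  by rewrite detN oppr_gt0; exact: mesh_h.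
have H1 : det (f n m) (f n.+1 m) < 0 \/
    det (f n m) (f n.+1 m) = 0 /\ det (f n.+1 m.+1) (f n m) < 0.
  case: m nm BC CD => [|m] nm BC CD; last by left; apply: (mesh_h M).
  right; have [v [t [t0 ti tf]]] := mesh_axis_n M.
  have [_ tp] := increasing_pos t0 ti.
  rewrite addn0 in nm; case: n nm BC CD => // n _ BC _.
  move: BC; rewrite !tf !det_scale_l !det_scale_r (detN v (f _ _)) => BC.
  split; first by rewrite det_self !mulr0.
  rewrite mulrN oppr_lt0.
  by rewrite mulr_gt0 ?tp //; move: BC; rewrite pmulr_rgt0.
have H2 : det (f n m.+1) (f n m) < 0 \/
    det (f n m.+1) (f n m) = 0 /\ det (f n m) (f n.+1 m.+1) < 0.
  case: n nm BC CD {H1} => [|n] nm BC CD; last first.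
    by left; rewrite detN oppr_lt0; apply: (mesh_v M).
  right; have [v [t [t0 ti tf]]] := mesh_axis_m M.
  have [_ tp] := increasing_pos t0 ti.
  rewrite add0n in nm; case: m nm BC CD => // m _ _ CD.
  move: CD; rewrite !tf !det_scale_l !det_scale_r (detN (f _ _) v) => CD.
  split; first by rewrite det_self !mulr0.
  by rewrite mulrN oppr_lt0 mulr_gt0 ?tp //; move: CD; rewrite pmulr_rgt0.
have := crossing_origin_np (det_plucker d (f n m) (f n.+1 m) (f n.+1 m.+1)) BC H1.
have := crossing_origin_pn (det_plucker d (f n.+1 m.+1) (f n m.+1) (f n m)) CD H2.
rewrite -!/(chi0 _ _ _) (chi0_rev d (f n.+1 m.+1) (f n m)); lia.
Qed.

(** By [grid_sum] both totals live on the boundary. Axis edges contribute 0, and on the outer sides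
    [chi <= chi0]; the total of [chi0] reduces to the face at the origin. *)
Lemma mesh_winding_le1 f d s K : polar_mesh f -> 0 <= s -> (0 < K)%N ->
  \sum_(0 <= n < K) \sum_(0 <= m < K) quad_sum (chi d s) f n m <= 1.
Proof.
move=> M s0 K0.
have [v1 [t1 [t10 t1i t1f]]] := mesh_axis_n M.
have [v2 [t2 [t20 t2i t2f]]] := mesh_axis_m M.
have tot : \sum_(0 <= n < K) \sum_(0 <= m < K) quad_sum (chi0 d) f n m =
   quad_sum (chi0 d) f 0 0.
  case: K K0 => // K _; rewrite big_nat_recl // big_nat_recl // [X in _ + X +
    _]big1_seq.
    rewrite addr0 big1_seq ?addr0 // => n _; rewrite big1_seq // => m _.
    exact: quad_sum_chi0.
  by move=> m _; apply: quad_sum_chi0.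
(* The two edges off the axes share [f 1 1]: a passage on the first needs [det d (f 1 1) >= 0], on
   the second [det d (f 1 1) < 0]. *)
have Q00 : quad_sum (chi0 d) f 0 0 <= 1.
  rewrite /quad_sum.
  have -> : chi0 d (f 0%N 0%N) (f 1%N 0%N) = 0 by rewrite !t1f chi0_axis.
  have -> : chi0 d (f 0%N 1%N) (f 0%N 0%N) = 0 by rewrite !t2f chi0_axis.
  rewrite add0r addr0 /chi0.
  rewrite !crossing_pos; last 2 first.
  - by rewrite detN oppr_gt0; exact: (mesh_h M).
  - exact: (mesh_v M).
  case: (ltP (det d (f 1%N 1%N)) 0) => h; rewrite ?andbF ?andFb /=.
    by rewrite add0r; case: (0 <= _).
  by rewrite addr0; case: (_ && _).
apply: le_trans Q00; rewrite -tot !grid_sum; [|exact: chi0_rev|exact: chi_rev].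
have z1 (c : R[i] -> R[i] -> int) : (forall n, c (f n 0%N) (f n.+1 0%N) = 0) ->
    \sum_(0 <= n < K) c (f n 0%N) (f n.+1 0%N) = 0.
  by move=> H; rewrite big1_seq // => n _.
have z2 (c : R[i] -> R[i] -> int) : (forall m, c (f 0%N m) (f 0%N m.+1) = 0) ->
    \sum_(0 <= m < K) c (f 0%N m) (f 0%N m.+1) = 0.
  by move=> H; rewrite big1_seq // => m _.
rewrite (z1 (chi d s)); last by move=> n; rewrite !t1f chi_axis.
rewrite (z1 (chi0 d)); last by move=> n; rewrite !t1f chi0_axis.
rewrite (z2 (chi d s)); last by move=> m; rewrite !t2f chi_axis.
rewrite (z2 (chi0 d)); last by move=> m; rewrite !t2f chi0_axis.
rewrite !add0r !subr0 lerD //; apply: ler_sum => n _; apply: chi_le_chi0.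
  exact: (mesh_v M).
by rewrite detN oppr_gt0; exact: (mesh_h M).
Qed.

Lemma mesh_quad_ge0 f d s n m : polar_mesh f -> 0 <= quad_sum (chi d s) f n m.
Proof.
move=> M; rewrite /quad_sum; case: (mesh_tri M n m) => [[a b]|[a b]].
  exact: (chi_quad_ge0 d s a b).
by have := chi_quad_ge0 d s a b; lia.
Qed.

Lemma mesh_disjoint f d s n m n' m' : polar_mesh f -> 0 <= s ->
  1 <= quad_sum (chi d s) f n m -> 1 <= quad_sum (chi d s) f n' m' ->
  (n, m) = (n', m').
Proof.
move=> M s0 H H'; apply/eqP/negP => /negP ne.
pose K := (maxn (maxn n m) (maxn n' m')).+1.
have := @mesh_winding_le1 f d s K M s0 (ltn0Sn _).
have Q0 i j : 0 <= quad_sum (chi d s) f i j by exact: mesh_quad_ge0.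
rewrite !big_mkord.
under eq_bigr do rewrite big_mkord.
rewrite pair_big /=.
have nK : (n < K)%N by rewrite /K; lia.
have mK : (m < K)%N by rewrite /K; lia.
have n'K : (n' < K)%N by rewrite /K; lia.
have m'K : (m' < K)%N by rewrite /K; lia.
rewrite (bigD1 (Ordinal nK, Ordinal mK)) //= (bigD1 (Ordinal n'K, Ordinal m'K)) /=;
  last first.
  apply: contraNN ne => /eqP[-> ->]; exact: eqxx.
set S := (X in _ + (_ + X) <= _) => le1.
have S0 : 0 <= S by apply: sumr_ge0.
by move: S0 le1 H H' => /=; lia.
Qed.

End Mesh.

(** * Interiors of quadrilaterals *)

Section Region.
Context {R : realType}.
Implicit Types (a b c d p q r t z : R[i]).

Lemma norm_complex z : exists2 x : R, 0 <= x & `|z| = x%:C.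
Proof.
have h : 0 <= `|z| by exact: normr_ge0.
exists (complex.Re `|z|).
  by move: h; rewrite lecE => /andP[].
by move: h; case: `|z| => x y; rewrite lecE /= => /andP[/eqP -> _].
Qed.

Lemma ray_continuous p (v : R[i]) :
  continuous (fun x : R => (p + x%:C * v) : R[i]^o).
Proof.
move=> x; apply/(@cvgrPdist_lt _ R[i]^o) => e e0.
have [er er0 eE] : exists2 y : R, 0 < y & e = y%:C.
  move: e0; case: e => a b; rewrite ltcE /= => /andP[/eqP b0 a0].
  by exists a => //; rewrite b0.
have [nv nv0 nvE] := norm_complex v.
have nv1 : 0 < nv + 1 by lra.
near=> y.
rewrite (_ : p + x%:C * v - (p + y%:C * v) = (x - y)%:C * v); last first.
  by rewrite rmorphB /=; ring.
rewrite normrM nvE eE.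
have -> : `|(x - y)%:C| = `|x - y|%:C by rewrite normc_def /= expr0n /= addr0 sqrtr_sqr.
rewrite -rmorphM ltcR.
have H : `|x - y| < er / (nv + 1).
  by near: y; apply: cvgr_dist_lt => //; rewrite divr_gt0.
have : `|x - y| * nv <= `|x - y| * (nv + 1) by rewrite ler_wpM2l //; lra.
by move/le_lt_trans; apply; rewrite -ltr_pdivlMr.
Unshelve. all: by end_near. Qed.

Definition outer_ray p z : set R[i]^o :=
  (fun x : R => (p + x%:C * (z - p)) : R[i]^o) @` `[1, +oo[.

Lemma outer_ray_connected p z : connected (outer_ray p z).
Proof.
apply: connected_continuous_connected.
  by apply/connected_intervalP; exact: interval_is_interval.
by apply: continuous_subspaceT => x; exact: ray_continuous.
Qed.

Lemma outer_ray_id p z : outer_ray p z z.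
Proof.
exists 1; first by rewrite /= in_itv /= lexx.
by rewrite mul1r addrC subrK.
Qed.

Lemma outer_ray_unbounded p z (C : set R[i]^o) : z != p ->
  outer_ray p z `<=` C -> ~ bounded_set C.
Proof.
move=> zp sC [M [Mreal HM]].
have [np np0 npE] := norm_complex p.
have [nv nv0 nvE] := norm_complex (z - p).
have nv1 : 0 < nv.
  rewrite lt_def nv0 andbT; apply: contraNneq zp => H.
  by move: nvE; rewrite H => /eqP; rewrite normr_eq0 subr_eq0.
have [m mE] : exists m : R, M = m%:C by apply/complex_realP.
pose B : R := `|m| + 1.
have mB : m < B by rewrite /B; have := ler_norm m; lra.
pose x : R := 1 + (B + np + 1) / nv.
have B0 : 0 < B by rewrite /B ltr_wpDl.
have x1 : 1 <= x by rewrite /x lerDl divr_ge0 //; lra.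
have Cx : C (p + x%:C * (z - p)).
  by apply: sC; exists x => //; rewrite /= in_itv /= x1.
have := HM B%:C; rewrite mE ltcR => /(_ mB _ Cx) /=.
have : `|x%:C * (z - p)| <= `|p + x%:C * (z - p)| + `|p|.
  by rewrite -[X in `|X| <= _](addKr p) addrC -[X in _ <= _ + X]normrN;
    exact: ler_normD.
have [ny ny0 ->] := norm_complex (p + x%:C * (z - p)).
rewrite normrM nvE npE.
have -> : `|x%:C| = x%:C by rewrite ger0_norm // (lecR 0); lra.
rewrite -rmorphM -rmorphD !lecR => H1 H2.
have : x * nv = nv + (B + np + 1) by rewrite /x mulrDl mul1r divfK // gt_eqF.
lra.
Qed.

Lemma side_on_ray p z a b (x : R) :
  side a b (p + x%:C * (z - p)) = (1 - x) * side a b p + x * side a b z.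
Proof.
by case: a b p z => [ax ay] [bx by_] [px py] [zx zy]; rewrite /side /det /=; ring.
Qed.

Lemma side_on_segment u v a b (x : R) :
  side a b ((1 - x)%:C * u + x%:C * v) = (1 - x) * side a b u + x * side a b v.
Proof.
by case: a b u v => [ax ay] [bx by_] [px py] [zx zy]; rewrite /side /det /=; ring.
Qed.

Lemma side_self a b : (side a b a = 0) * (side a b b = 0) * (side a a b = 0).
Proof. by case: a b => [ax ay] [bx by_]; rewrite /side /det /=; do ![split]; ring. Qed.

Lemma side_cycle a b c : side b c a = side a b c.
Proof.
by case: a b c => [ax ay] [bx by_] [cx cy]; rewrite /side /det /=; ring.
Qed.

Definition closed_triangle a b c z : Prop :=
  [/\ 0 <= side a b z, 0 <= side b c z & 0 <= side c a z].

(** Along the ray from [a], two of the [side] functions are proportional to [x], and the third is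
    affine with a positive value at [a]. *)
Lemma closed_triangle_star a b c z (x : R) : 0 < side a b c -> 1 <= x ->
  closed_triangle a b c (a + x%:C * (z - a)) -> closed_triangle a b c z.
Proof.
move=> D x1 []; rewrite !side_on_ray !side_self (side_cycle a b c) !mulr0 !add0r =>
  H1 H2 H3.
have x0 : 0 < x by lra.
split.
- by move: H1; rewrite pmulr_rge0.
- rewrite -(pmulr_rge0 _ x0).
  have : 0 <= (x - 1) * side a b c by rewrite mulr_ge0 //; lra.
  by move: H2; lra.
- by move: H3; rewrite pmulr_rge0.
Qed.

Lemma segment_in_triangle a b c z : 0 < side a b c -> segment a b z ->
  closed_triangle a b c z.
Proof.
move=> D [x]; rewrite /= in_itv /= => /andP[x0 x1] <-.
rewrite /closed_triangle !side_on_segment !side_self (side_cycle a b c) (side_cycle b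
  c a) (side_cycle a b c).
by rewrite !mulr0 !addr0 add0r; split => //; rewrite mulr_ge0 //; lra.
Qed.

Lemma triangle_rot a b c z : closed_triangle a b c z -> closed_triangle b c a z.
Proof. by case. Qed.

Lemma side0_segment a b c z : 0 < side a b c -> side a b z = 0 ->
  0 <= side b c z -> 0 <= side c a z -> segment a b z.
Proof.
move=> D H0 H1 H2; have S := side_sum a b c z.
(* The barycentric coordinate of [z] at [b]. *)
exists (side c a z / side a b c).
  rewrite /= in_itv /= divr_ge0 ?(ltW D) //= ler_pdivrMr // mul1r.
  by rewrite -S H0; lra.
have D0 : side a b c != 0 by rewrite gt_eqF.
move: D0 H0; case: a b c z {D H1 H2 S} => [ax ay] [bx by_] [cx cy] [zx zy].
rewrite /side /det /= => D0 H0; apply/eqP; rewrite eq_complex /=.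
set D := (X in X != 0) in D0.
set q := (_ / _).
have qE : q * D = (ax - cx) * (zy - cy) - (ay - cy) * (zx - cx).
  by rewrite /q divfK.
apply/andP; split; apply/eqP; apply: (mulIf D0).
  rewrite (_ : _ * D = ax * D + (q * D) * (bx - ax)); last by ring.
  rewrite qE.
  rewrite (_ : zx * D = zx * D - (cx - ax) * 0); last by ring.
  by rewrite -H0 /D; ring.
rewrite (_ : _ * D = ay * D + (q * D) * (by_ - ay)); last by ring.
rewrite qE.
rewrite (_ : zy * D = zy * D - (cy - ay) * 0); last by ring.
by rewrite -H0 /D; ring.
Qed.

(* Both triangles are star-shaped with respect to [p], so from a point outside
   them the ray pointing away from [p] escapes to infinity off the boundary. *)
Lemma inner_part_in_triangles p q r t z : 0 < side p q r -> 0 < side p r t ->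
  inner_part p q r t z -> closed_triangle p q r z \/ closed_triangle p r t z.
Proof.
move=> D1 D2 [nbz bnd]; apply: contrapT => nK.
have K_star (x : R) : 1 <= x -> closed_triangle p q r (p + x%:C * (z - p)) \/
    closed_triangle p r t (p + x%:C * (z - p)) -> False.
  move=> x1 [H|H]; apply: nK; [left|right]; exact: closed_triangle_star x1 H.
have zp : z != p.
  apply/eqP => E; apply: (K_star 1) => //; rewrite E subrr mulr0 addr0; left.
  by split; rewrite ?side_self ?(side_cycle p q r) // ltW.
apply: (outer_ray_unbounded (p := p) zp _ bnd).
apply: connected_component_max; [exact: outer_ray_id| |exact: outer_ray_connected].
move=> y [x /=]; rewrite in_itv /= andbT => x1 <- H; apply: (K_star x x1).
have D1' : 0 < side q r p by rewrite side_cycle.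
have D2' : 0 < side r t p by rewrite side_cycle.
have D2'' : 0 < side t p r by rewrite side_cycle.
case: H => [[[H|H]|H]|H].
- by left; exact: segment_in_triangle.
- by left; do 2!apply: triangle_rot; exact: segment_in_triangle.
- by right; do 2!apply: triangle_rot; exact: segment_in_triangle.
- by right; apply: triangle_rot; exact: segment_in_triangle.
Qed.

(** In the closed triangle that contains [z], no [side] can vanish except the one of the diagonal
    [p r], as [z] is off the polygon. *)
Lemma inner_part_region p q r t z : 0 < side p q r -> 0 < side p r t ->
  inner_part p q r t z ->
  [\/ [/\ 0 < side p q z, 0 < side q r z & 0 < side r p z],
      [/\ 0 < side p r z, 0 < side r t z & 0 < side t p z] |
      [/\ side p r z = 0, 0 < side p q z /\ 0 < side q r z &
          0 < side r t z /\ 0 < side t p z]].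
Proof.
move=> D1 D2 I; have [nb _] := I.
have D1' : 0 < side q r p by rewrite side_cycle.
have D2' : 0 < side r t p by rewrite side_cycle.
have D2'' : 0 < side t p r by rewrite side_cycle.
have pos (x : R) : 0 <= x -> x <> 0 -> 0 < x by move=> x0 /eqP xn; rewrite lt_def xn.
case: (inner_part_in_triangles D1 D2 I) => [[h1 h2 h3]|[h1 h2 h3]].
  have {}h1 : 0 < side p q z.
    by apply: pos => // E; apply: nb; left; left; left; exact: (side0_segment D1).
  have {}h2 : 0 < side q r z.
    by apply: pos => // E; apply: nb; left; left; right;
      apply: (side0_segment D1') => //; exact: ltW.
  case: (ltgtP 0 (side r p z)) => h; [by constructor 1| |].
    by move: h3; rewrite leNgt h.
  constructor 3; rewrite side_rev -h oppr0; split => //.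
  (* On the line [p r] corresponding sides of the two triangles are proportional, so positivity
     transfers from one to the other. *)
  have E1 : side r t z * side p q r = side q r z * side p r t.
    apply/eqP; rewrite -subr_eq0; apply/eqP.
    rewrite -[RHS](mulr0 (side r t q)) [X in _ = _ * X]h.
    by case: (p) (q) (r) (t) (z) => [??] [??] [??] [??] [??]; rewrite /side /det /=;
      ring.
  have E2 : side t p z * side p q r = side p q z * side p r t.
    apply/eqP; rewrite -subr_eq0; apply/eqP.
    rewrite -[RHS](mulr0 (side t p q)) [X in _ = _ * X]h.
    by case: (p) (q) (r) (t) (z) => [??] [??] [??] [??] [??]; rewrite /side /det /=;
      ring.
  split; rewrite -(pmulr_lgt0 _ D1) ?E1 ?E2 mulr_gt0 //.
have {}h2 : 0 < side r t z.
  by apply: pos => // E; apply: nb; left; right; apply: (side0_segment D2').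
have {}h3 : 0 < side t p z.
  by apply: pos => // E; apply: nb; right; apply: (side0_segment D2'') => //;
    exact: ltW.
case: (ltgtP 0 (side p r z)) => h; [by constructor 2| |].
  by move: h1; rewrite leNgt h.
constructor 3; split => //.
have E1 : side p q z * side p r t = side t p z * side p q r.
  apply/eqP; rewrite -subr_eq0; apply/eqP.
  rewrite -[RHS](mulr0 (side p q t)) [X in _ = _ * X]h.
  by case: (p) (q) (r) (t) (z) => [??] [??] [??] [??] [??]; rewrite /side /det /=; ring.
have E2 : side q r z * side p r t = side r t z * side p q r.
  apply/eqP; rewrite -subr_eq0; apply/eqP.
  rewrite -[RHS](mulr0 (side q r t)) [X in _ = _ * X]h.
  by case: (p) (q) (r) (t) (z) => [??] [??] [??] [??] [??]; rewrite /side /det /=; ring.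
split; rewrite -(pmulr_lgt0 _ D2) ?E1 ?E2 mulr_gt0 //.
Qed.

Lemma inner_part_rot p q r t : inner_part p q r t = inner_part q r t p.
Proof.
have E : quad_boundary p q r t = quad_boundary q r t p.
  by rewrite /quad_boundary -!setUA setUC !setUA.
by rewrite /inner_part E.
Qed.

(** Each face with [z] in its interior contributes at least 1 to a total that is at most 1. *)
Lemma polar_mesh_embedded (f : nat -> nat -> R[i]) : polar_mesh f -> embedded f.
Proof.
move=> M n m n' m' ne; apply/seteqP; split => // z [H H'].
(* The ray points away from the origin; for [z = 0] any direction serves. *)
have [d [s [d0 s0 zE]]] : exists d (s : R), [/\ d != 0, 0 <= s & z = s%:C * d].
  have [->|z0] := eqVneq z 0.
    by exists 1, 0; split => //; rewrite ?oner_neq0 ?mul0r.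
  by exists z, 1; split => //; rewrite ?ler01 ?mul1r.
have Q k l : elementary_quad_inner f k l z -> 1 <= quad_sum (chi d s) f k l.
  rewrite /elementary_quad_inner zE; case: (mesh_tri M k l) => -[a b].
    by move/(inner_part_region a b); exact: (chi_quad_inside d0 a b).
  rewrite inner_part_rot => /(inner_part_region a b) /(chi_quad_inside d0 a b).
  by rewrite /quad_sum; lia.
exact: ne (mesh_disjoint M s0 (Q _ _ H) (Q _ _ H')).
Qed.

End Region.

(** * The geometry of the circle pattern *)

Section Geometry.
Context {R : realType}.
Implicit Types (alpha gamma c : R) (u z : R[i]) (f w : nat -> nat -> R[i]).

(** Multiplication by a number of modulus 1 preserves [det], and
    [det 1 (expi alpha) = sin alpha]. *)
Lemma det_frame alpha u (x1 y1 x2 y2 : R) : u * u^* = 1 ->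
  det (u * (x1%:C + expi alpha * y1%:C)) (u * (x2%:C + expi alpha * y2%:C)) =
  (x1 * y2 - y1 * x2) * sin alpha.
Proof.
case: u => a b /eqP; rewrite eq_complex /= => /andP[/eqP H _].
have {}H : a ^+ 2 + b ^+ 2 = 1 by rewrite -H; ring.
rewrite /expi /det /=; rewrite -[RHS]mul1r -H; ring.
Qed.

Lemma ray_of_increments (g : nat -> R[i]) (d : R[i]) (rho : nat -> R) : g 0%N = 0 ->
  (forall n, 0 < rho n) -> (forall n, g n.+1 - g n = (rho n)%:C * d) ->
  exists d (t : nat -> R), [/\ t 0%N = 0, forall n, t n < t n.+1 & forall n, g n =
    (t n)%:C * d].
Proof.
move=> g0 rp gd; exists d, (fun n => \sum_(i < n) rho i); split.
- by rewrite big_ord0.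
- by move=> n; rewrite big_ord_recr /= ltrDl.
- elim=> [|n IH]; first by rewrite big_ord0 mul0r.
  by rewrite big_ord_recr /= rmorphD mulrDl -IH -gd addrC subrK.
Qed.

Section Pattern.
Variables (alpha gamma : R) (f w : nat -> nat -> R[i]).
Hypotheses (a0 : 0 < alpha) (api : alpha < pi) (g0 : 0 < gamma).
Hypothesis c1 : `|gamma - 1| < 1.
Hypothesis L : hirota_lift 1 (expi alpha) f w.
Hypothesis C : constrained 1 (expi alpha) gamma%:C f w.
Hypothesis Z : zpattern (expi alpha) (gamma - 1) w.
Hypothesis w01 : w 0%N 1%N = expi ((gamma - 1) * alpha).
Hypothesis f00 : f 0%N 0%N = 0.

Let r n m := complex.Re (w n m).
Let ee : expi alpha * (expi alpha)^* = 1 := expi_conj_mul alpha.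

Lemma radius_gt0 n m : ~~ odd (n + m) -> 0 < r n m.
Proof. exact: (zpattern_positive a0 api c1 Z w01). Qed.

Lemma radiusE n m : ~~ odd (n + m) -> w n m = (r n m)%:C.
Proof. exact: (zpattern_Re ee c1 Z). Qed.

Lemma unimodE n m : odd (n + m) -> w n m * (w n m)^* = 1.
Proof. by move=> o; have := zpattern_reality ee c1 Z n m; rewrite o. Qed.

Lemma sin_alpha_gt0 : 0 < sin alpha.
Proof. by rewrite sin_gt0_pi // a0. Qed.

(** The neighbours of an odd vertex carry positive radii, so the constraint divided by [gamma] gives
    the coordinates of [f] in the frame [w], [e^(i alpha) w]. *)
Lemma odd_position n m : odd (n + m) -> exists A B : R,
  [/\ f n m = w n m * (A%:C + expi alpha * B%:C),
    (0 < n)%N -> 0 < A & (0 < m)%N -> 0 < B].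
Proof.
move=> o.
have gC : gamma%:C != 0 by rewrite eq_complex /= eqxx andbT gt_eqF.
pose A := if n is n'.+1 then 2 * n%:R * (r n.+1 m * r n' m / (r n.+1 m +
  r n' m)) / gamma else 0.
pose B := if m is m'.+1 then 2 * m%:R * (r n m.+1 * r n m' / (r n m.+1 +
  r n m')) / gamma else 0.
have EA : 1 * (2 * n%:R * (w n m * (w n.+1 m * w n.-1 m / (w n.+1 m + w n.-1 m)))) =
   gamma%:C * (w n m * A%:C).
  rewrite /A; case: n o {A B} => [|n] o; first by rewrite !mulr0 !mul0r !mulr0.
  have o1 : ~~ odd (n.+2 + m) by move: o; rewrite !addSn /= negbK.
  have o2 : ~~ odd (n + m) by move: o; rewrite addSn.
  rewrite (radiusE o1) (radiusE o2) /= !(rmorphM, rmorphD, fmorphV) /= !rmorph_nat.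
  field; rewrite gC /= -rmorphD eq_complex /= eqxx andbT.
  by rewrite gt_eqF // addr_gt0 // radius_gt0.
have EB : expi alpha * (2 * m%:R * (w n m * (w n m.+1 * w n m.-1 / (w n m.+1 +
  w n m.-1)))) =
   gamma%:C * (w n m * (expi alpha * B%:C)).
  rewrite /B; case: m o {A B EA} => [|m] o; first by rewrite !mulr0 !mul0r !mulr0.
  have o1 : ~~ odd (n + m.+2) by move: o; rewrite !addnS /= negbK.
  have o2 : ~~ odd (n + m) by move: o; rewrite addnS.
  rewrite (radiusE o1) (radiusE o2) /= !(rmorphM, rmorphD, fmorphV) /= !rmorph_nat.
  field; rewrite gC /= -rmorphD eq_complex /= eqxx andbT.
  by rewrite gt_eqF // addr_gt0 // radius_gt0.
exists A, B; split.
- by apply: (mulfI gC); rewrite (cst_eq C) EA EB; ring.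
- rewrite /A; case: n o {A B EA EB} => // n o _.
  have o1 : ~~ odd (n.+2 + m) by move: o; rewrite !addSn /= negbK.
  have o2 : ~~ odd (n + m) by move: o; rewrite addSn.
  have := radius_gt0 o1; have := radius_gt0 o2 => H1 H2.
  by rewrite divr_gt0 // !mulr_gt0 ?invr_gt0 ?addr_gt0 ?ltr0n.
- rewrite /B; case: m o {A B EA EB} => // m o _.
  have o1 : ~~ odd (n + m.+2) by move: o; rewrite !addnS /= negbK.
  have o2 : ~~ odd (n + m) by move: o; rewrite addnS.
  have := radius_gt0 o1; have := radius_gt0 o2 => H1 H2.
  by rewrite divr_gt0 // !mulr_gt0 ?invr_gt0 ?addr_gt0 ?ltr0n.
Qed.

Lemma detBr (a b : R[i]) : det a b = det a (b - a).
Proof. by case: a b => [??] [??]; rewrite /det /=; ring. Qed.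

Lemma detBl (a b : R[i]) : det a b = det b (b - a).
Proof. by case: a b => [??] [??]; rewrite /det /=; ring. Qed.

Lemma det_odd_v n m (x : R) : odd (n + m) -> (0 < n)%N -> 0 < x ->
  0 < det (f n m) (w n m * (0%:C + expi alpha * x%:C)).
Proof.
move=> o n0 x0; have [A [B [-> A0 _]]] := odd_position o.
rewrite det_frame ?unimodE // mulr0 subr0.
by rewrite !mulr_gt0 ?A0 // sin_alpha_gt0.
Qed.

Lemma det_odd_h n m (x : R) : odd (n + m) -> (0 < m)%N -> 0 < x ->
  det (f n m) (w n m * (x%:C + expi alpha * 0%:C)) < 0.
Proof.
move=> o m0 x0; have [A [B [-> _ B0]]] := odd_position o.
rewrite det_frame ?unimodE // mulr0 sub0r.
by rewrite mulNr oppr_lt0 !mulr_gt0 ?B0 // sin_alpha_gt0.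
Qed.

(** Every edge is a radius times [w] or [e^(i alpha) w] at its odd end, which reduces all signs to
    [det_frame]. *)
Lemma pattern_polar_mesh : polar_mesh f.
Proof.
have sa := sin_alpha_gt0.
have lh n m : f n.+1 m - f n m = w n m * w n.+1 m by rewrite (lift_h L) mul1r.
have lv n m : f n m.+1 - f n m = expi alpha * (w n m * w n m.+1) by rewrite (lift_v L).
split.
- have E k : k.+1%:R * ratio (w k.+2 0%N) (w k 0%N) = if odd k.+1 then (gamma -
  1)%:C else 0.
    by have := zp_euler Z k.+1 0%N; rewrite /euler mul0r addr0 addn0.
  have ax := axis_values c1 (fun n => zp_sum_n Z n 0%N) E (zp_00 Z).
  (* On this axis [w] is 1 at odd vertices, so each increment is the radius at the even end. *)
  apply: (@ray_of_increments _ 1 (fun n => if odd n then r n.+1 0%N else r n 0%N)) =>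
    // n.
    by case: ifPn => od; apply: radius_gt0; rewrite addn0 //= negbK.
  rewrite lh mulr1; have := ax n; have := ax n.+1; rewrite /=.
  case: (boolP (odd n)) => od h1 h2 /=.
    by rewrite h2 (zp_10 Z) mul1r radiusE // addn0 /= negbK.
  by rewrite h1 (zp_10 Z) mulr1 radiusE // addn0.
- have E k : k.+1%:R * ratio (w 0%N k.+2) (w 0%N k) = if odd k.+1 then (gamma -
  1)%:C else 0.
    by have := zp_euler Z 0%N k.+1; rewrite /euler mul0r add0r add0n.
  have ax := axis_values c1 (fun m => zp_sum_m Z 0%N m) E (zp_00 Z).
  apply: (@ray_of_increments _ (expi alpha * w 0%N 1%N)
      (fun m => if odd m then r 0%N m.+1 else r 0%N m)) => // m.
    by case: ifPn => od; apply: radius_gt0; rewrite add0n //= negbK.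
  rewrite lv; have := ax m; have := ax m.+1; rewrite /=.
  case: (boolP (odd m)) => od h1 h2 /=.
    by rewrite h2 (radiusE (m := m.+1)) ?add0n /= ?negbK //; ring.
  by rewrite h1 (radiusE (m := m)) ?add0n //; ring.
- move=> n m n0; case: (boolP (odd (n + m))) => od.
    rewrite detBr lv (_ : _ * _ = w n m * (0%:C + expi alpha * (r n m.+1)%:C)).
      by apply: det_odd_v => //; apply: radius_gt0; rewrite addnS /= negbK.
    rewrite -radiusE; last by rewrite addnS /= negbK.
    by rewrite rmorph0; ring.
  rewrite detBl lv (_ : _ * _ = w n m.+1 * (0%:C + expi alpha * (r n m)%:C)).
    by apply: det_odd_v; [rewrite addnS /= od|exact: n0|exact: radius_gt0].
  by rewrite -radiusE // rmorph0; ring.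
- move=> n m m0; case: (boolP (odd (n + m))) => od.
    rewrite detBr lh (_ : _ * _ = w n m * ((r n.+1 m)%:C + expi alpha * 0%:C)).
      by apply: det_odd_h => //; apply: radius_gt0; rewrite addSn /= negbK.
    rewrite -radiusE; last by rewrite addSn /= negbK.
    by rewrite rmorph0; ring.
  rewrite detBl lh (_ : _ * _ = w n.+1 m * ((r n m)%:C + expi alpha * 0%:C)).
    by apply: det_odd_h; [rewrite addSn /= od|exact: m0|exact: radius_gt0].
  by rewrite -radiusE // rmorph0; ring.
(* The face is cut along the diagonal joining its even vertices; twice the area of each half is the
   product of the two radii and [sin alpha]. *)
- move=> n m; case: (boolP (odd (n + m))) => od; [right|left].
    have oB : ~~ odd (n.+1 + m) by rewrite addSn /= negbK.
    have oD : ~~ odd (n + m.+1) by rewrite addnS /= negbK.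
    have oC : odd (n.+1 + m.+1) by rewrite addSn addnS /= negbK.
    have rB := radius_gt0 oB; have rD := radius_gt0 oD.
    split; rewrite /side.
      rewrite lv (_ : f n m.+1 - f n.+1 m = (f n.+1 m.+1 - f n.+1 m) - (f n.+1 m.+1 -
        f n m.+1)); last by ring.
      rewrite lv lh.
      rewrite (_ : expi alpha * (w n.+1 m * w n.+1 m.+1) =
        w n.+1 m.+1 * (0%:C + expi alpha * (r n.+1 m)%:C)); last first.
        by rewrite -(radiusE oB) rmorph0; ring.
      rewrite (_ : w n.+1 m.+1 * _ - _ = w n.+1 m.+1 * ((- r n m.+1)%:C +
        expi alpha * (r n.+1 m)%:C)); last first.
        by rewrite rmorphN /= -(radiusE oB) -(radiusE oD) rmorph0; ring.
      rewrite det_frame ?unimodE // mul0r sub0r mulrN opprK.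
      by rewrite !mulr_gt0.
    rewrite (_ : f n m - f n.+1 m = - (f n.+1 m - f n m)); last by ring.
    rewrite (_ : f n m.+1 - f n.+1 m = (f n m.+1 - f n m) - (f n.+1 m - f n m));
      last by ring.
    rewrite lv lh.
    rewrite (_ : expi alpha * _ - _ = w n m * ((- r n.+1 m)%:C +
      expi alpha * (r n m.+1)%:C)); last first.
      by rewrite rmorphN /= -(radiusE oB) -(radiusE oD); ring.
    rewrite (_ : - (w n m * w n.+1 m) = w n m * ((- r n.+1 m)%:C +
      expi alpha * 0%:C)); last first.
      by rewrite rmorphN /= -(radiusE oB) rmorph0; ring.
    rewrite det_frame ?unimodE // mulr0 sub0r mulrN opprK.
    by rewrite !mulr_gt0.
have oC : ~~ odd (n.+1 + m.+1) by rewrite addSn addnS /= negbK.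
have oB : odd (n.+1 + m) by rewrite addSn.
have oD : odd (n + m.+1) by rewrite addnS.
have rA := radius_gt0 od; have rC := radius_gt0 oC.
split; rewrite /side.
  rewrite (_ : f n.+1 m.+1 - f n m = (f n.+1 m - f n m) + (f n.+1 m.+1 - f n.+1 m));
    last by ring.
  rewrite lv lh.
  rewrite (_ : w n m * w n.+1 m + _ = w n.+1 m * ((r n m)%:C +
    expi alpha * (r n.+1 m.+1)%:C)); last first.
    by rewrite -(radiusE od) -(radiusE oC); ring.
  rewrite (_ : w n m * w n.+1 m = w n.+1 m * ((r n m)%:C + expi alpha * 0%:C));
    last first.
    by rewrite -(radiusE od) rmorph0; ring.
  rewrite det_frame ?unimodE // mul0r subr0.
  by rewrite !mulr_gt0.
rewrite (_ : f n.+1 m.+1 - f n m = (f n m.+1 - f n m) + (f n.+1 m.+1 - f n m.+1));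
  last by ring.
rewrite lv lh.
rewrite (_ : expi alpha * _ + _ = w n m.+1 * ((r n.+1 m.+1)%:C +
  expi alpha * (r n m)%:C)); last first.
  by rewrite -(radiusE od) -(radiusE oC); ring.
rewrite (_ : expi alpha * (w n m * w n m.+1) = w n m.+1 * (0%:C +
  expi alpha * (r n m)%:C)); last first.
  by rewrite -(radiusE od) rmorph0; ring.
rewrite det_frame ?unimodE // mulr0 subr0.
by rewrite !mulr_gt0.
Qed.

End Pattern.
End Geometry.

Theorem theorem1 (R : realType) (alpha gamma : R) (f : nat -> nat -> R[i])
    (halpha : 0 < alpha /\ alpha < pi) (hgamma : 0 < gamma /\ gamma < 2%:R)
    (hf : discrete_Zgamma alpha gamma f) :
  embedded f.
Proof.
case: halpha hgamma => a0 api [g0 g2].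
have [w [L C Z w01 f00]] := discrete_Zgamma_zpattern a0 api g0 hf.
have c1 : `|gamma - 1| < 1 by rewrite ltr_norml; apply/andP; split; lra.
exact: polar_mesh_embedded (pattern_polar_mesh a0 api g0 c1 L C Z w01 f00).
Qed.
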